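(* Let $K$ be a nonnegative admissible Volterra kernel satisfying Assumption F, let $\kappa,\theta,\eta,v_0>0$, $x\ge0$, and for $\varepsilon\in(0,1]$ let $$dV^{(\varepsilon)}_t=\kappa(\theta-V^{(\varepsilon)}_t)dt+\sqrt\varepsilon\,\eta\sqrt{V^{(\varepsilon)}_t}\,dB_t,\quad V^{(\varepsilon)}_0=v_0,\qquad \widehat B^{(\varepsilon)}_t=x+\int_0^tK(t,s)V^{(\varepsilon)}_sds,\quad t\in[0,T],$$ where $B$ is a standard Brownian motion (canonical set-up). Then Assumption B holds for the generalized fractional Heston model with this volatility process and volatility function $\sigma(u)=\sqrt u$: for every $\alpha>0$ there exist $\varepsilon_0\in(0,1]$ and $M>0$ depending only on $\alpha$ such that for all $0<\varepsilon<\varepsilon_0$ $$\mathbb E\left[\exp\left\{\alpha\int_0^T\sigma(\widehat B^{(\varepsilon)}_s)^2ds\right\}\right]=\mathbb E\left[\exp\left\{\alpha\int_0^T\widehat B^{(\varepsilon)}_sds\right\}\right]\le M.$$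
   Context: $T>0$. A real function $K$ on $[0,T]^2$ is an admissible Volterra kernel if it is Borel measurable, Lebesgue square-integrable over $[0,T]^2$, for every $t\in(0,T]$ the slice $s\mapsto K(t,s)$ belongs to $L^2[0,T]$ and is not almost everywhere zero, and $K(t,s)=0$ for $s>t$. *Assumption F* for $K$: there is a modulus of continuity $\zeta$ (nonnegative, nondecreasing, $\zeta(s)\to0$ as $s\to0$) with $\int_{b}^\infty\zeta(u^{-1})(\log u)^{-1/2}\frac{du}{u}<\infty$ for some $b>1$ and $$\sup_{t,s\in[0,T],\,|t-s|\le\tau}\int_0^T(K(t,u)-K(s,u))^2du\le\zeta^2(\tau),\quad\tau\in[0,T].$$ The scaled generalized fractional Heston model is $dS^{(\varepsilon)}_t=S^{(\varepsilon)}_t\big[r\,dt+\sqrt\varepsilon\sqrt{\widehat B^{(\varepsilon)}_t}(\sqrt{1-\rho^2}\,dW_t+\rho\,dB_t)\big]$ with $V^{(\varepsilon)},\widehat B^{(\varepsilon)}$ as in the claim, $W$ a Brownian motion independent of $B$, $r\ge0$, $\rho\in(-1,1)$. The model ($K,\kappa,\theta,\eta,v_0,x,T$) is fixed; ''depending only on $\alpha$'' is meant for the given model. *)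

(* Defs.v *)
From HB Require Import structures.
From mathcomp Require Import all_boot all_order all_algebra.
From mathcomp Require Import all_classical all_reals all_analysis.
Set Implicit Arguments.
Unset Strict Implicit.
Unset Printing Implicit Defensive.
Import Order.TTheory GRing.Theory Num.Theory.
Import numFieldNormedType.Exports.
Local Open Scope classical_set_scope.
Local Open Scope ring_scope.

Section volterra_kernels.
Context {R : realType}.
Implicit Types (T : R) (K : R -> R -> R).
Local Notation mu := (@lebesgue_measure R).

(* Kernels on [0, T]^2 are total functions on R^2; only their values on
   [0, T]^2 are ever constrained or used. *)
Record admissible_volterra_kernel T K : Prop := AdmissibleVolterraKernel {
  avk_measurable :
    measurable_fun (`[0, T] `*` `[0, T]) (fun p : R * R => K p.1 p.2) ;
  avk_square_integrable :
    (\int[(mu \x mu)%E]_(p in `[0%R, T] `*` `[0%R, T])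
       ((K p.1 p.2) ^+ 2)%:E < +oo)%E ;
  avk_slice_measurable : forall t : R, t \in `]0, T] ->
    measurable_fun `[0, T] (K t) ;
  avk_slice_square_integrable : forall t : R, t \in `]0, T] ->
    (\int[mu]_(s in `[0%R, T]) ((K t s) ^+ 2)%:E < +oo)%E ;
  avk_slice_nonzero : forall t : R, t \in `]0, T] ->
    ~ {ae mu, forall s : R, s \in `[0, T] -> K t s = 0} ;
  avk_volterra : forall t s : R, t \in `[0, T] -> s \in `[0, T] -> t < s ->
    K t s = 0 }.

Record modulus_of_continuity (zeta : R -> R) : Prop := ModulusOfContinuity {
  modulus_ge0 : forall s : R, 0 <= s -> 0 <= zeta s ;
  modulus_nondecreasing : forall s t : R, 0 <= s -> s <= t -> zeta s <= zeta t ;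
  modulus_cvg0 : zeta s @[s --> 0^'+] --> (0 : R) }.

Definition assumption_F T K : Prop :=
  exists zeta : R -> R, [/\
    modulus_of_continuity zeta,
    exists2 b : R, 1 < b &
      (\int[mu]_(u in `[b, +oo[)
         (zeta u^-1 * (ln u) `^ (- 2^-1) / u)%:E < +oo)%E &
    forall tau : R, tau \in `[0, T] ->
      (ereal_sup [set \int[mu]_(u in `[0%R, T]) ((K p.1 u - K p.2 u) ^+ 2)%:E
        | p in [set p : R * R | [/\ p.1 \in `[0%R, T], p.2 \in `[0%R, T]
                                  & (`|p.1 - p.2| <= tau)%R]]]
       <= ((zeta tau) ^+ 2)%:E)%E].

End volterra_kernels.

Section filtrations.
Context {d : measure_display} {Omega : measurableType d} {R : realType}.
Variable P : probability Omega R.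
Implicit Types (X : R -> Omega -> R) (F : R -> set (set Omega)).

(* Events { X_u in A } with 0 <= u <= t. *)
Definition history X (t : R) : set (set Omega) :=
  [set E | exists2 u, u \in `[0, t] &
           exists2 A : set R, measurable A & E = X u @^-1` A].

Definition null_events : set (set Omega) :=
  [set N | measurable N /\ P N = 0%E].

(* Augmented filtrations generated by one and by two processes. *)
Definition augmented_filtration X (t : R) : set (set Omega) :=
  <<s history X t `|` null_events >>.

Definition augmented_filtration2 X Y (t : R) : set (set Omega) :=
  <<s history X t `|` history Y t `|` null_events >>.

Definition independent_events (G H : set (set Omega)) : Prop :=
  forall A B, G A -> H B -> P (A `&` B) = (P A * P B)%E.

Definition measurable_wrt (G : set (set Omega)) (f : Omega -> R) : Prop :=
  forall A : set R, measurable A -> G (f @^-1` A).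

Definition continuous_process (T : R) X : Prop :=
  forall w, {within `[0, T], continuous (fun t => X t w)}.

Definition adapted (T : R) F X : Prop :=
  forall t : R, t \in `[0, T] -> measurable_wrt (F t) (X t).

(* For every t, (s, w) |-> X s w restricted to [0, t] x Omega is measurable for
   the product of the Borel sigma-algebra with F t. *)
Definition progressively_measurable (T : R) F X : Prop :=
  forall t : R, t \in `[0, T] -> forall A : set R, measurable A ->
    <<s [set E : set (R * Omega) | exists2 C : set R, measurable C &
          exists2 D, F t D & E = C `*` D] >>
      [set p : R * Omega | p.1 \in `[0, t] /\ A (X p.1 p.2)].

Record brownian_motion (T : R) X : Prop := BrownianMotion {
  bm_measurable : forall t : R, t \in `[0, T] -> measurable_fun setT (X t) ;
  bm_start : forall w, X 0 w = 0 ;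
  bm_continuous : continuous_process T X ;
  bm_gaussian : forall s t : R, 0 <= s -> s < t -> t <= T ->
    forall A : set R, measurable A ->
    P [set w | A (X t w - X s w)] = normal_prob 0 (Num.sqrt (t - s)) A ;
  bm_independent : forall s t : R, 0 <= s -> s < t -> t <= T ->
    independent_events <<s history X s >>
      [set E | exists2 A : set R, measurable A &
               E = [set w | A (X t w - X s w)]] }.

Definition independent_processes (T : R) X Y : Prop :=
  independent_events <<s history X T >> <<s history Y T >>.

End filtrations.

Section ito_integral.
Context {d : measure_display} {Omega : measurableType d} {R : realType}.
Variable P : probability Omega R.
Implicit Types (X H I : R -> Omega -> R) (F : R -> set (set Omega)).
Local Notation mu := (@lebesgue_measure R).

(* The step process
     \sum_(i < sp_size) sp_coef i * 1_(]sp_time i, sp_time i.+1]). *)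
Record step_process := StepProcess {
  sp_size : nat ;
  sp_time : nat -> R ;
  sp_coef : nat -> Omega -> R }.

Record simple_process (T : R) F (h : step_process) : Prop := SimpleProcess {
  sp_time_ge0 : 0 <= sp_time h 0 ;
  sp_time_nondecreasing : forall i, (i < sp_size h)%N ->
    sp_time h i <= sp_time h i.+1 ;
  sp_time_le : sp_time h (sp_size h) <= T ;
  sp_coef_bounded : forall i, (i < sp_size h)%N ->
    exists M : R, forall w, `|sp_coef h i w| <= M ;
  sp_coef_measurable : forall i, (i < sp_size h)%N ->
    measurable_wrt (F (sp_time h i)) (sp_coef h i) }.

Definition sp_value (h : step_process) (t : R) (w : Omega) : R :=
  \sum_(i < sp_size h)
    sp_coef h i w * \1_(`]sp_time h i, sp_time h i.+1]) t.

Definition sp_integral (h : step_process) X (t : R) (w : Omega) : R :=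
  \sum_(i < sp_size h)
    sp_coef h i w * (X (Num.min (sp_time h i.+1) t) w
                     - X (Num.min (sp_time h i) t) w).

Definition cvg0_in_probability (Z : nat -> Omega -> \bar R) : Prop :=
  forall delta : R, 0 < delta ->
    P [set w | (delta%:E < Z n w)%E] @[n --> \oo] --> 0%E.

(* I is (a continuous version of) t |-> \int_0^t H dX on [0, T], for X a
   Brownian motion relative to the filtration F: H is progressively measurable
   with \int_0^T H^2 ds < oo almost surely, and I is the limit, uniformly on
   [0, T] in probability, of the integrals of simple processes approximating H
   in L^2([0, T]) in probability. *)
Definition is_ito_integral (T : R) F X H I : Prop :=
  [/\ progressively_measurable T F H,
      {ae P, forall w, (\int[mu]_(s in `[0%R, T]) ((H s w) ^+ 2)%:E < +oo)%E},
      adapted T F I,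
      continuous_process T I &
      exists h : nat -> step_process, [/\
        forall n, simple_process T F (h n),
        cvg0_in_probability (fun n w =>
          (\int[mu]_(s in `[0%R, T]) ((sp_value (h n) s w - H s w) ^+ 2)%:E)%E)
      & cvg0_in_probability (fun n w =>
          ereal_sup [set (`|sp_integral (h n) X t w - I t w|%:E)%E
                    | t in `[0, T]])]].

End ito_integral.

Section heston_model.
Context {d : measure_display} {Omega : measurableType d} {R : realType}.
Variable P : probability Omega R.
Local Notation mu := (@lebesgue_measure R).

(* The nonnegative strong solution (adapted to the augmented filtration of the
   driving Brownian motion B) on [0, T] of
     dV_t = kappa (theta - V_t) dt + vol sqrt(V_t) dB_t,  V_0 = v0. *)
Record cir_solution (T kappa theta vol v0 : R) (B V : R -> Omega -> R) : Prop :=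
  CirSolution {
    cir_adapted : adapted T (augmented_filtration P B) V ;
    cir_continuous : continuous_process T V ;
    cir_ge0 : forall (t : R) w, t \in `[0, T] -> 0 <= V t w ;
    cir_equation : exists2 I : R -> Omega -> R,
      is_ito_integral P T (augmented_filtration P B) B
        (fun t w => Num.sqrt (V t w)) I &
      {ae P, forall w, forall t : R, t \in `[0, T] ->
        V t w = v0 + \int[mu]_(s in `[0, t]) (kappa * (theta - V s w))
                + vol * I t w} }.

Definition volterra_process (K : R -> R -> R) (x : R) (V : R -> Omega -> R)
    (t : R) (w : Omega) : R :=
  x + \int[mu]_(s in `[0, t]) (K t s * V s w).

(* dS_t = S_t (r dt + eps^(1/2) sigma(Y_t) ((1 - rho^2)^(1/2) dW_t + rho dB_t)),
   S_0 = s0. *)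
Record asset_price_solution (T r rho eps s0 : R) (sigma : R -> R)
    (W B Y S : R -> Omega -> R) : Prop := AssetPriceSolution {
  asset_adapted : adapted T (augmented_filtration2 P W B) S ;
  asset_continuous : continuous_process T S ;
  asset_equation : exists IW IB : R -> Omega -> R, [/\
    is_ito_integral P T (augmented_filtration2 P W B) W
      (fun t w => S t w * sigma (Y t w)) IW,
    is_ito_integral P T (augmented_filtration2 P W B) B
      (fun t w => S t w * sigma (Y t w)) IB &
    {ae P, forall w, forall t : R, t \in `[0, T] ->
      S t w = s0 + \int[mu]_(s in `[0, t]) (r * S s w)
              + Num.sqrt eps
                * (Num.sqrt (1 - rho ^+ 2) * IW t w + rho * IB t w)}] }.

(* E[exp(alpha \int_0^T f(Y_s) ds)] *)
Definition exponential_moment (T alpha : R) (f : R -> R)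
    (Y : R -> Omega -> R) : \bar R :=
  (\int[P]_w expeR (alpha%:E * \int[mu]_(s in `[0%R, T]) (f (Y s w))%:E))%E.

End heston_model.

(* Main.v *)
Require Import Defs.
From HB Require Import structures.
From mathcomp Require Import all_boot all_order all_algebra.
From mathcomp Require Import all_classical all_reals all_analysis.
From mathcomp Require Import measurable_realfun ring lra.
Set Implicit Arguments.
Unset Strict Implicit.
Unset Printing Implicit Defensive.
Import Order.TTheory GRing.Theory Num.Theory.
Import numFieldNormedType.Exports.
Local Open Scope classical_set_scope.
Local Open Scope ring_scope.

(** The drift of the CIR process compensates its own exponential martingale:
    for [c > 0] the equation for [V] reads
    [c V_t = c v0 + c kappa theta t - c kappa \int_0^t V + lam I_t] with
    [I = \int sqrt V dB] and [lam = c sqrt eps eta], so once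
    [lam^2 <= c kappa] (that is, for small [eps]) it is enough to bound
    [E exp (lam I_t - lam^2 \int_0^t V)].  For a simple process [h] the
    exponential [exp (lam (h . B)_t - lam^2 / 2 \int_0^t h^2)] has expectation
    1.  When [h] is within 1 of [sqrt V] in [L^2] and [(h . B)_t] within 1 of
    [I_t], the doubled compensator absorbs [\int h^2 <= 2 \int V + 2], so the
    former exponential is at most [exp (lam + lam^2)] times the latter; the
    exceptional events have vanishing probability and the bound survives.
    Hence [E exp (c V_t)] is bounded uniformly in [t <= T] and small [eps].
    Since the kernel is square integrable, hence integrable, on [[0, T]^2],
    Jensen's inequality for the measure [(K(t, s) + 1) ds dt] and Tonelli's
    theorem turn this into a bound for
    [E exp (alpha \int_0^T (x + \int_0^t K(t, s) V_s ds) dt)]. *)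

(** * Integrals of exponentials *)

Section lebesgue_facts.
Context d (T : measurableType d) (R : realType).
Variable mu : {measure set T -> \bar R}.
Local Open Scope ereal_scope.
Import HBNNSimple.

(* [f] and [g] need not be measurable: the integral of a nonnegative function
   is a supremum over the simple functions below it. *)
Lemma le_integral_nomeas (D : set T) (f g : T -> \bar R) :
  (forall x, D x -> 0 <= f x) -> (forall x, D x -> f x <= g x) ->
  \int[mu]_(x in D) f x <= \int[mu]_(x in D) g x.
Proof.
move=> f0 fg; rewrite integral_mkcond [leRHS]integral_mkcond.
have rf x : 0 <= (f \_ D) x by exact: erestrict_ge0.
have rfg x : (f \_ D) x <= (g \_ D) x by exact: lee_restrict.
have rg x : 0 <= (g \_ D) x by exact: le_trans (rf x) (rfg x).
rewrite !ge0_integralTE//; apply: ereal_sup_le => _ [h hf <-].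
by exists h => // x; exact: le_trans (hf x) (rfg x).
Qed.

(** Jensen's inequality for the probability measure of density [k / a] and the function [a * f],
    whose mean is the integral of [k * f]. The tangent of the exponential at this mean lies below
    the exponential; integrating that comparison against [k] gives the bound. *)
Lemma expeR_integral_le (D : set T) (k f : T -> R) (a : R) :
  measurable D -> measurable_fun D k -> measurable_fun D f ->
  (forall x, D x -> (0 <= k x)%R) -> (forall x, D x -> (0 <= f x)%R) ->
  (0 < a)%R -> \int[mu]_(x in D) (k x)%:E = a%:E ->
  expeR (\int[mu]_(x in D) (k x * f x)%:E) <=
  a^-1%:E * \int[mu]_(x in D) (k x * expR (a * f x))%:E.
Proof.
move=> mD mk mf k0 f0 a0 ka.
set J := \int[mu]_(x in D) _; set E := \int[mu]_(x in D) _.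
have J0 : 0 <= J.
  by apply: integral_ge0 => x Dx; rewrite lee_fin mulr_ge0 ?k0 ?f0.
have me : measurable_fun D (fun x => (k x * expR (a * f x))%R).
  apply: measurable_funM => //; apply: measurableT_comp => //.
  exact: measurable_funM.
have E0 : 0 <= E.
  by apply: integral_ge0 => x Dx; rewrite lee_fin mulr_ge0 ?k0 ?expR_ge0.
have mkf : measurable_fun D (fun x => (k x * f x)%R) by exact: measurable_funM.
(* From [y <= expR y]. Hence [J] is finite as soon as [E] is, and the real tangent point [m] exists
   in the only nontrivial case. *)
have aJE : a%:E * J <= E.
  rewrite -ge0_integralZl_EFin//; last 3 first.
  - by move=> x Dx; rewrite lee_fin mulr_ge0 ?k0 ?f0.
  - exact/measurable_EFinP.
  - exact: ltW.
  apply: ge0_le_integral => //.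
  - move=> x Dx; rewrite -EFinM lee_fin mulr_ge0 ?(ltW a0)// mulr_ge0 ?k0 ?f0//.
  - by apply/measurable_EFinP; exact: measurable_funM.
  - exact/measurable_EFinP.
  - move=> x Dx; rewrite -EFinM lee_fin mulrCA ler_wpM2l ?k0//.
    by apply: le_trans (expR_ge1Dx _); rewrite lerDr.
have [->|Eoo] := eqVneq E +oo.
  by rewrite gt0_muley ?leey// lte_fin invr_gt0.
have Jfin : J \is a fin_num.
  rewrite ge0_fin_numE// ltey; apply: contra_neq Eoo => Joo.
  by move: aJE; rewrite Joo gt0_muley ?lte_fin// leye_eq => /eqP.
pose m := fine J.
have Jm : J = m%:E by rewrite fineK.
rewrite Jm /=.
rewrite lee_pdivlMl// -EFinM.
pose e := expR m.
have e0 : (0 <= e)%R by exact: expR_ge0.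
have m0 : (0 <= m)%R by exact: fine_ge0.
have mD1 : measurable_fun D (fun x => (k x * e * m)%R).
  by do 2 apply: measurable_funM => //.
have mD2 : measurable_fun D (fun x => (e * a * (k x * f x))%R).
  exact: measurable_funM.
have mD3 : measurable_fun D (fun x => (k x * e)%R) by exact: measurable_funM.
have keI : \int[mu]_(x in D) (k x * e)%:E = (a * e)%:E.
  under eq_integral do rewrite mulrC EFinM.
  rewrite ge0_integralZl_EFin//; last first.
  - exact/measurable_EFinP.
  by rewrite ka -EFinM mulrC.
have kemI : \int[mu]_(x in D) (k x * e * m)%:E = (a * e * m)%:E.
  under eq_integral do rewrite mulrC EFinM.
  rewrite ge0_integralZl_EFin//; last 2 first.
  - by move=> x Dx; rewrite lee_fin mulr_ge0 ?k0.
  - exact/measurable_EFinP.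
  by rewrite keI -EFinM mulrC.
(* The tangent bound [e * (1 + (a * f x - m)) <= expR (a * f x)], multiplied by [k x]. The negative
   term is moved to the right so that both sides are sums of nonnegative functions and split without
   any integrability argument. *)
have key : \int[mu]_(x in D) ((k x * e)%:E + (e * a * (k x * f x))%:E) <=
   \int[mu]_(x in D) ((k x * e * m)%:E + (k x * expR (a * f x))%:E).
  apply: ge0_le_integral => //.
  - move=> x Dx; rewrite adde_ge0// lee_fin ?mulr_ge0 ?k0 ?f0//; exact: ltW.
  - by apply: emeasurable_funD; exact/measurable_EFinP.
  - by apply: emeasurable_funD; exact/measurable_EFinP.
  - move=> x Dx; rewrite -!EFinD lee_fin.
    have -> : (k x * e + e * a * (k x * f x) = k x * (e * (1 + a * f x)))%R by ring.
    have -> : (k x * e * m + k x * expR (a * f x) =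
      k x * (e * m + expR (a * f x)))%R by ring.
    rewrite ler_wpM2l ?k0//.
    have := expR_ge1Dx (a * f x - m); rewrite expRD expRN -/e => h.
    have e1 : (0 < e)%R by exact: expR_gt0.
    have : (e * (1 + (a * f x - m)) <= expR (a * f x))%R.
      by rewrite mulrC -ler_pdivlMr.
    lra.
move: key; rewrite !ge0_integralD//; last 8 first.
- by move=> x Dx; rewrite lee_fin !mulr_ge0 ?k0.
- exact/measurable_EFinP.
- by move=> x Dx; rewrite lee_fin mulr_ge0 ?k0 ?expR_ge0.
- exact/measurable_EFinP.
- by move=> x Dx; rewrite lee_fin mulr_ge0 ?k0.
- exact/measurable_EFinP.
- by move=> x Dx; rewrite lee_fin !mulr_ge0 ?k0 ?f0// ltW.
- exact/measurable_EFinP.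
rewrite -/E keI kemI.
under eq_integral do rewrite EFinM.
rewrite ge0_integralZl_EFin//; last 3 first.
- by move=> x Dx; rewrite lee_fin mulr_ge0 ?k0 ?f0.
- exact/measurable_EFinP.
- by rewrite mulr_ge0// ltW.
rewrite -/J Jm -[E]fineK ?ge0_fin_numE ?ltey//.
rewrite -EFinM -!EFinD !lee_fin -/e; lra.
Qed.
End lebesgue_facts.

(** Jensen is applied for each [w], Tonelli exchanges the two integrals, and the moment bound is
    used for each [p]; the mass [a] of [k] then cancels the factor [a^-1]. *)
Lemma ge0_expeR_integral_le d1 d2 (Omega : measurableType d1)
    (S : measurableType d2) (R : realType) (P : probability Omega R)
    (m : {sigma_finite_measure set S -> \bar R}) (k : S -> R)
    (f : Omega * S -> R) (a C : R) :
  0 < a -> measurable_fun setT k -> (forall p, 0 <= k p) ->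
  (\int[m]_p (k p)%:E = a%:E)%E ->
  measurable_fun setT f -> (forall q, 0 <= f q) ->
  (forall p, \int[P]_w (expR (a * f (w, p)))%:E <= C%:E)%E ->
  (\int[P]_w expeR (\int[m]_p (k p * f (w, p))%:E) <= C%:E)%E.
Proof.
move=> a0 mk k0 ka mf f0 fC.
pose g (q : Omega * S) := (k q.2 * expR (a * f q))%:E.
have mg : measurable_fun setT g.
  apply/measurable_EFinP; apply: measurable_funM; first exact: measurableT_comp.
  by apply: measurableT_comp => //; exact: measurable_funM.
have g0 q : (0 <= g q)%E by rewrite lee_fin mulr_ge0 ?expR_ge0.
apply: (@le_trans _ _ (\int[P]_w (a^-1%:E * \int[m]_p g (w, p)))%E).
  apply: le_integral_nomeas => w _; first exact: expeR_ge0.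
  apply: expeR_integral_le => //.
  exact: (@measurableT_comp _ _ _ _ _ _ f _ (pair w)).
rewrite ge0_integralZl_EFin ?invr_ge0 ?(ltW a0)//; last 2 first.
- by move=> w _; exact: integral_ge0.
- exact: measurable_fun_fubini_tonelli_F.
rewrite fubini_tonelli// lee_pdivrMl//.
apply: (@le_trans _ _ (\int[m]_p (C%:E * (k p)%:E))%E).
  apply: le_integral_nomeas => p _; first exact: integral_ge0.
  under eq_integral do rewrite /g/= EFinM.
  rewrite ge0_integralZl_EFin//; last first.
    apply/measurable_EFinP; apply: measurableT_comp => //.
    apply: measurable_funM => //.
    exact: (@measurableT_comp _ _ _ _ _ _ f _ (pair^~ p)).
  by rewrite muleC lee_wpmul2r// lee_fin.
have C0 : 0 <= C.
  rewrite -lee_fin; apply: le_trans (fC point); apply: integral_ge0 => w _.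
  by rewrite lee_fin expR_ge0.
rewrite ge0_integralZl_EFin//; last 2 first.
- by move=> p _; rewrite lee_fin.
- exact/measurable_EFinP.
by rewrite ka muleC.
Qed.

(** * Gaussian densities and exponential moments *)

Section normal_moments.
Context (R : realType).
Local Notation mu := (@lebesgue_measure R).
Local Open Scope ereal_scope.

(** The Radon-Nikodym derivative of the normal law and [normal_pdf] have the same integral over
    every measurable set, so they agree almost everywhere. *)
Lemma ge0_integral_normal_prob (m s : R) (f : R -> \bar R) :
  (forall x, 0 <= f x) -> measurable_fun setT f ->
  \int[normal_prob m s]_x f x = \int[mu]_x (f x * (normal_pdf m s x)%:E).
Proof.
move=> f0 mf; have dom := normal_prob_dominates m s.
rewrite -(Radon_Nikodym_SigmaFinite.change_of_variables dom)//.
have mg := measurable_int _ (Radon_Nikodym_SigmaFinite.f_integrable dom).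
apply: ae_eq_integral => //.
- exact: emeasurable_funM.
- apply: emeasurable_funM => //; apply/measurable_EFinP.
  exact: measurable_normal_pdf.
- apply: ae_eqe_mul2l; apply: integral_ae_eq => //.
  + exact: Radon_Nikodym_SigmaFinite.f_integrable.
  + by apply/measurable_EFinP; exact: measurable_normal_pdf.
  + by move=> E _ mE; rewrite -Radon_Nikodym_SigmaFinite.f_integral.
Qed.

(** Completing the square: [expR (a * z)] times the centred density is a constant times the density
    with mean [a * s ^+ 2], which has total mass 1. *)
Lemma integral_normal_prob_expR (s a : R) : s != 0%R ->
  \int[normal_prob 0 s]_z (expR (a * z))%:E = (expR (a ^+ 2 * s ^+ 2 / 2))%:E.
Proof.
move=> s0; rewrite ge0_integral_normal_prob//; last first.
  by apply/measurable_EFinP; apply: measurableT_comp => //; exact: measurable_funM.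
transitivity (\int[mu]_z ((expR (a ^+ 2 * s ^+ 2 / 2))%:E *
  (normal_pdf (a * s ^+ 2) s z)%:E)).
  apply: eq_integral => z _; rewrite -!EFinM; congr EFin.
  rewrite !normal_pdfE// /normal_fun mulrCA [RHS]mulrCA; congr (_ * _)%R.
  by rewrite -!expRD; congr expR; field.
rewrite ge0_integralZl_EFin ?integral_normal_pdf ?mule1 ?expR_ge0//.
  by move=> z _; rewrite lee_fin normal_pdf_ge0.
by apply/measurable_EFinP; exact: measurable_normal_pdf.
Qed.

End normal_moments.

(** * Integrating out an independent variable *)

Section freezing.
Context d d1 d2 (Omega : measurableType d) (T1 : measurableType d1)
  (T2 : measurableType d2) (R : realType).
Variables (P : probability Omega R) (nu : probability T2 R).
Local Open Scope ereal_scope.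

(** The product hypothesis says, on rectangles, that the joint law of [X] and [Z] is the law of [X]
    times [nu]. Uniqueness of the product measure extends this to all measurable sets, and Tonelli
    concludes. *)
Lemma ge0_integral_indep (X : Omega -> T1) (Z : Omega -> T2)
    (f : T1 * T2 -> \bar R) :
  measurable_fun setT X -> measurable_fun setT Z ->
  (forall A C, measurable A -> measurable C ->
     P (X @^-1` A `&` Z @^-1` C) = P (X @^-1` A) * nu C) ->
  measurable_fun setT f -> (forall p, 0 <= f p) ->
  \int[P]_w f (X w, Z w) = \int[P]_w \int[nu]_z f (X w, z).
Proof.
move=> mX mZ XZ mf f0.
have mXZ : measurable_fun setT (fun w => (X w, Z w)).
  exact: measurable_fun_pair.
pose X' : {mfun Omega >-> T1} := HB.pack X (isMeasurableFun.Build _ _ _ _ _ mX).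
pose XZ' : {mfun Omega >-> (T1 * T2)%type} :=
  HB.pack (fun w => (X w, Z w)) (isMeasurableFun.Build _ _ _ _ _ mXZ).
have E A : measurable A -> (distribution P X' \x nu) A = distribution P XZ' A.
  apply: product_measure_unique => B C mB mC.
  exact: XZ.
transitivity (\int[distribution P XZ']_p f p).
  by rewrite ge0_integral_pushforward//= preimage_setT.
rewrite -(@eq_measure_integral _ _ _ _ _ (distribution P X' \x nu)); last first.
  by move=> A mA _; exact: E.
rewrite fubini_tonelli1// ge0_integral_pushforward//=.
- exact: measurable_fun_fubini_tonelli_F.
- by move=> y _; exact: integral_ge0.
Qed.

End freezing.

(** * Brownian motion and its augmented filtration *)

Section augmented_filtration_theory.
Context d (Omega : measurableType d) (R : realType).
Variable P : probability Omega R.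
Implicit Types (X : R -> Omega -> R) (s t : R).

Lemma history_le X s t : s <= t -> history X s `<=` history X t.
Proof.
move=> st E [u us EA]; exists u => //.
by move: us; rewrite !in_itv/= => /andP[-> us]; exact: le_trans st.
Qed.

Lemma augmented_filtration_le X s t : s <= t ->
  augmented_filtration P X s `<=` augmented_filtration P X t.
Proof.
by move=> st; apply: sub_sigma_algebra2; apply: setSU; exact: history_le.
Qed.

Lemma history_sub_augmented X t :
  <<s history X t >> `<=` augmented_filtration P X t.
Proof. by apply: sub_sigma_algebra2; exact: subsetUl. Qed.

Lemma g_history_measurable X t :
  (forall u, u \in `[0, t] -> measurable_fun setT (X u)) ->
  <<s history X t >> `<=` measurable.
Proof.
move=> mX; apply: smallest_sub; first exact: sigma_algebra_measurable.
by move=> _ [u ut [A mA ->]]; rewrite -[_ @^-1` _]setTI; exact: mX.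
Qed.

Lemma augmented_filtration_measurable X t :
  (forall u, u \in `[0, t] -> measurable_fun setT (X u)) ->
  augmented_filtration P X t `<=` measurable.
Proof.
move=> mX; apply: smallest_sub; first exact: sigma_algebra_measurable.
move=> E [HE|[]//]; apply: g_history_measurable mX _ _.
exact: sub_sigma_algebra.
Qed.

(** The events that differ from an event of the raw history by a negligible set form a
    sigma-algebra, and it contains both the history and the null events. *)
Lemma augmented_filtration_history X t E : augmented_filtration P X t E ->
  exists2 E', <<s history X t >> E' & P.-negligible ((E `\` E') `|` (E' `\` E)).
Proof.
move: E; apply: smallest_sub.
- have sH : sigma_algebra setT <<s history X t >> by exact: smallest_sigma_algebra.
  split.
  + exists set0; first by case: sH.
    by rewrite !setD0 setU0; exact: negligible_set0.
  + move=> A [A' HA' nA]; exists (~` A').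
      by rewrite -setTD; case: sH => _ + _; exact.
    apply: negligibleS nA => w; rewrite setTD /=.
    by move=> [[nA nnA']|[nA' nnA]]; [right|left]; split => //; apply: contrapT.
  + move=> F hF.
    have /choice[F' hF'] : forall n, exists E', <<s history X t >> E' /\
        P.-negligible ((F n `\` E') `|` (E' `\` F n)).
      by move=> n; have [E' ? ?] := hF n; exists E'.
    exists (\bigcup_n F' n).
      by case: sH => _ _; apply => n; exact: (hF' n).1.
    apply: (@negligibleS _ _ _ _ (\bigcup_n ((F n `\` F' n) `|` (F' n `\` F n)))).
      move=> w /= [[[n _ Fn] nF']|[[n _ Fn] nF]]; exists n => //.
        by left; split => // F'n; apply: nF'; exists n.
      by right; split => // Fn'; apply: nF; exists n.
    by apply: negligible_bigcup => n; exact: (hF' n).2.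
- move=> E [HE|[mE PE]].
    exists E; first exact: sub_sigma_algebra.
    by rewrite setDv setU0; exact: negligible_set0.
  exists set0.
    exact: sigma_algebra0.
  by rewrite setD0 set0D setU0; exact/negligibleP.
Qed.

Lemma negligible_symdiff_eq (E E' : set Omega) : measurable E -> measurable E' ->
  P.-negligible ((E `\` E') `|` (E' `\` E)) -> P E = P E'.
Proof.
move=> mE mE' nE.
have n1 : P (E `\` E') = 0%E.
  by apply/negligibleP; [exact: measurableD|exact: negligibleS nE].
have n2 : P (E' `\` E) = 0%E.
  by apply/negligibleP; [exact: measurableD|exact: negligibleS nE].
rewrite (measureDI P mE mE') (measureDI P mE' mE).
by rewrite [X in X + _](_ : _ = 0%E)// [X in _ = X + _](_ : _ = 0%E)// setIC.
Qed.

(** A Brownian motion is only assumed to have increments independent of its raw history. An event of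
    the augmented filtration is replaced by a history event up to a negligible set, which changes no
    probability. *)
Lemma augmented_increment_independent (T : R) X s t :
  brownian_motion P T X -> 0 <= s -> s < t -> t <= T ->
  forall E A, augmented_filtration P X s E -> measurable A ->
  P (E `&` [set w | A (X t w - X s w)]) =
    (P E * normal_prob 0 (Num.sqrt (t - s)) A)%E.
Proof.
move=> BX s0 st tT E A FE mA.
have mX u : u \in `[0, s] -> measurable_fun setT (X u).
  rewrite in_itv/= => /andP[u0 us]; apply: (bm_measurable BX).
  by rewrite in_itv/= u0 (le_trans us)// (le_trans _ tT)// ltW.
have mE : measurable E := augmented_filtration_measurable mX FE.
have [E' HE' nE] := augmented_filtration_history FE.
have mE' : measurable E' := g_history_measurable mX HE'.
set D := [set w | _].
have mD : measurable D.
  rewrite -[D]setTI; apply: measurable_funB => //; apply: (bm_measurable BX).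
    by rewrite in_itv/= tT (le_trans s0)// ltW.
  by rewrite in_itv/= s0 (le_trans _ tT)// ltW.
rewrite (negligible_symdiff_eq mE mE' nE).
rewrite (@negligible_symdiff_eq (E `&` D) (E' `&` D)); last 3 first.
- exact: measurableI.
- exact: measurableI.
- apply: negligibleS nE => w /=.
  by move=> [[[Ew Dw] nE']|[[Ew Dw] nE']]; [left|right]; split => // ?; exact: nE'.
rewrite -(bm_gaussian BX s0 st tT mA).
by apply: (bm_independent BX s0 st tT) => //; exists A.
Qed.

End augmented_filtration_theory.

(** * Exponential martingales of simple integrands *)

Section exponential_supermartingale.
Context d (Omega : measurableType d) (R : realType).
Variable P : probability Omega R.
Implicit Types (X : R -> Omega -> R) (s t : R).

(** Gives access to the closure properties of measurable functions when the source carries a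
    sub-sigma-algebra of the filtration. *)
Lemma measurable_wrtP (G : set (set Omega)) (f : Omega -> R) :
  measurable_wrt <<s G >> f <->
  measurable_fun [set: g_sigma_algebraType G] f.
Proof.
split=> [mf _ A mA|mf A mA]; first by rewrite setTI; exact: mf.
by rewrite -[_ @^-1` _]setTI; exact: mf.
Qed.

(** [N] and [xi] are known at time [s] and can be frozen while the independent increment is
    integrated out. Its Gaussian exponential moment is exactly what the compensator removes. The
    identity holds in [[0, +oo]]. *)
Lemma gaussian_step (T lam : R) X s t (N xi : Omega -> R) :
  brownian_motion P T X -> 0 <= s -> s < t -> t <= T ->
  measurable_wrt (augmented_filtration P X s) N ->
  measurable_wrt (augmented_filtration P X s) xi ->
  (\int[P]_w (expR (N w + (lam * (xi w * (X t w - X s w))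
      - lam ^+ 2 / 2 * (xi w ^+ 2 * (t - s)))))%:E = \int[P]_w (expR (N w))%:E)%E.
Proof.
move=> BX s0 st tT /measurable_wrtP mN /measurable_wrtP mxi.
have mX u : u \in `[0, T] -> measurable_fun setT (X u).
  by move=> uT; exact: (bm_measurable BX).
have mXs u : u \in `[0, s] -> measurable_fun setT (X u).
  rewrite in_itv/= => /andP[u0 us]; apply: mX.
  by rewrite in_itv/= u0 (le_trans us)// (le_trans _ tT)// ltW.
have sF : augmented_filtration P X s `<=` measurable.
  exact: augmented_filtration_measurable mXs.
have mNxi := measurable_fun_pair mN mxi.
pose Y w := (N w, xi w).
pose Z w := X t w - X s w.
have FY A : measurable A -> augmented_filtration P X s (Y @^-1` A).
  by move=> mA; rewrite -[_ @^-1` _]setTI; exact: mNxi.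
have mY : measurable_fun setT Y.
  by move=> _ A mA; rewrite setTI; apply: sF; exact: FY.
have mZ : measurable_fun setT Z.
  apply: measurable_funB; apply: mX.
    by rewrite in_itv/= tT (le_trans s0)// ltW.
  by rewrite in_itv/= s0 (le_trans _ tT)// ltW.
pose f (q : (R * R) * R) := (expR (q.1.1 + (lam * (q.1.2 * q.2)
      - lam ^+ 2 / 2 * (q.1.2 ^+ 2 * (t - s)))))%:E.
have mf : measurable_fun setT f.
  apply/measurable_EFinP; apply: measurableT_comp => //.
  have m11 : measurable_fun setT (fun q : (R * R) * R => q.1.1).
    exact: measurableT_comp.
  have m12 : measurable_fun setT (fun q : (R * R) * R => q.1.2).
    exact: measurableT_comp.
  apply: measurable_funD => //; apply: measurable_funB.
    by apply: measurable_funM => //; exact: measurable_funM.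
  apply: measurable_funM => //; apply: measurable_funM => //.
  exact: measurable_funX.
have ts0 : Num.sqrt (t - s) != 0 by rewrite sqrtr_eq0 -ltNge subr_gt0.
transitivity (\int[P]_w f (Y w, Z w))%E; first by [].
rewrite (@ge0_integral_indep _ _ _ _ _ _ _ P
  (normal_prob 0 (Num.sqrt (t - s))))//; first last.
- by move=> q; rewrite lee_fin expR_ge0.
- move=> A C mA mC.
  exact: (augmented_increment_independent BX s0 st tT (FY _ mA) mC).
apply: eq_integral => w _; rewrite /f /Y /=.
(* The exponent is split into a part constant in [z] and a part linear in [z]. *)
transitivity (\int[normal_prob 0 (Num.sqrt (t - s))]_z
  ((expR (N w - lam ^+ 2 / 2 * (xi w ^+ 2 * (t - s))))%:E *
  (expR ((lam * xi w) * z))%:E))%E.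
  by apply: eq_integral => z _; rewrite -EFinM -expRD; congr (expR _)%:E; ring.
rewrite ge0_integralZl_EFin//; last first.
  by apply/measurable_EFinP; apply: measurableT_comp => //; exact: measurable_funM.
rewrite integral_normal_prob_expR// sqr_sqrtr ?subr_ge0 1?ltW//.
by rewrite -EFinM -expRD; congr (expR _)%:E; field.
Qed.

(** The logarithm of the stochastic exponential of [lam] times the first [k] steps of [h], stopped
    at [t]. The separate parameter [k] allows induction on the number of steps. *)
Definition simple_exponent (lam : R) (h : step_process) X t (k : nat)
    (w : Omega) : R :=
  \sum_(i < k)
    (lam * (sp_coef h i w * (X (Num.min (sp_time h i.+1) t) w
                             - X (Num.min (sp_time h i) t) w))
     - lam ^+ 2 / 2 * (sp_coef h i w ^+ 2 *
         (Num.min (sp_time h i.+1) t - Num.min (sp_time h i) t))).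

Lemma simple_time_le (T : R) (F : R -> set (set Omega))
    (h : @step_process d Omega R) i j :
  simple_process T F h -> (i <= j)%N -> (j <= sp_size h)%N ->
  sp_time h i <= sp_time h j.
Proof.
move=> hs; elim: j => [|j IH]; first by rewrite leqn0 => /eqP ->.
rewrite leq_eqVlt => /predU1P[->//|]; rewrite ltnS => ij jn.
by apply: (le_trans (IH ij (ltnW jn))); exact: (sp_time_nondecreasing hs).
Qed.

(** By induction on the number of steps: by [gaussian_step], each further step leaves the
    expectation unchanged. *)
Lemma integral_expR_simple_exponent (T lam : R) X t (h : step_process) :
  brownian_motion P T X -> t \in `[0, T] ->
  simple_process T (augmented_filtration P X) h ->
  (\int[P]_w (expR (simple_exponent lam h X t (sp_size h) w))%:E = 1)%E.
Proof.
move=> BX; rewrite in_itv/= => /andP[t0 tT] hs.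
have h0 i : (i <= sp_size h)%N -> 0 <= sp_time h i.
  by move=> ih; apply: le_trans (sp_time_ge0 hs) _; exact: simple_time_le hs _ _.
have FX u v : 0 <= u -> u <= v -> measurable_wrt (augmented_filtration P X v) (X u).
  move=> u0 uv A mA; apply: history_sub_augmented.
  by apply: sub_sigma_algebra; exists u; [rewrite in_itv/= u0|exists A].
(* The partial exponent is known when step [k] begins, as [gaussian_step] requires of [N]. *)
have FN k : (k <= sp_size h)%N ->
    measurable_wrt (augmented_filtration P X (sp_time h k))
      (simple_exponent lam h X t k).
  move=> kn; apply/measurable_wrtP; apply: measurable_sum => i.
  pose G := history X (sp_time h k) `|` null_events P.
  have ik : (i.+1 <= k)%N by exact: ltn_ord.
  have iS : sp_time h i.+1 <= sp_time h k by exact: simple_time_le hs _ _.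
  have ii : sp_time h i <= sp_time h k.
    by apply: simple_time_le hs _ _ => //; exact: ltnW.
  have iltn : (i < sp_size h)%N by exact: leq_trans ik kn.
  have mc : measurable_fun [set: g_sigma_algebraType G] (sp_coef h i).
    apply/measurable_wrtP => A mA; apply: (augmented_filtration_le ii).
    exact: (sp_coef_measurable hs).
  have mX1 : measurable_fun [set: g_sigma_algebraType G]
      (X (Num.min (sp_time h i.+1) t)).
    apply/measurable_wrtP; apply: FX; first by rewrite le_min t0 andbT h0.
    by rewrite ge_min iS.
  have mX0 : measurable_fun [set: g_sigma_algebraType G] (X (Num.min (sp_time h i) t)).
    apply/measurable_wrtP; apply: FX; first by rewrite le_min t0 andbT h0// ltnW.
    by rewrite ge_min ii.
  apply: measurable_funB.
    apply: measurable_funM => //; apply: measurable_funM => //.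
    exact: measurable_funB.
  apply: measurable_funM => //; apply: measurable_funM => //.
  exact: measurable_funX.
suff H k : (k <= sp_size h)%N ->
    (\int[P]_w (expR (simple_exponent lam h X t k w))%:E = 1)%E by exact: H.
elim: k => [_|k IH kn].
  transitivity (\int[P]_w cst 1 w)%E; last first.
    by rewrite integral_cst// mul1e; exact: probability_setT.
  by apply: eq_integral => w _; rewrite /simple_exponent big_ord0 expR0.
rewrite -(IH (ltnW kn)).
(* [gaussian_step] needs an increment over a nondegenerate interval. A step that starts at or after
   [t], or that has length zero, contributes 0 to the exponent and is treated apart. *)
have [tk|kt] := leP t (sp_time h k).
  apply: eq_integral => w _; rewrite /simple_exponent big_ord_recr/=.
  rewrite !min_r//; last by apply: le_trans tk _; exact: (sp_time_nondecreasing hs).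
  by rewrite !subrr !mulr0 subrr addr0.
have [E|NE] := eqVneq (Num.min (sp_time h k.+1) t) (sp_time h k).
  apply: eq_integral => w _; rewrite /simple_exponent big_ord_recr/= E.
  rewrite min_l ?ltW//.
  by rewrite !subrr !mulr0 subrr addr0.
have lt : sp_time h k < Num.min (sp_time h k.+1) t.
  rewrite lt_neqAle eq_sym NE le_min (ltW kt) andbT.
  exact: (sp_time_nondecreasing hs).
rewrite -(@gaussian_step T lam X (sp_time h k) (Num.min (sp_time h k.+1) t)
  (simple_exponent lam h X t k) (sp_coef h k))//; last 4 first.
- exact/h0/ltnW.
- by rewrite ge_min tT orbT.
- exact: (FN _ (ltnW kn)).
- exact: (sp_coef_measurable hs).
apply: eq_integral => w _; rewrite /simple_exponent big_ord_recr/=.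
by rewrite [Num.min (sp_time h k) t]min_l// ltW.
Qed.

End exponential_supermartingale.

(** * Continuous and step processes *)

Section continuous_processes.
Context (R : realType).
Implicit Types (T t : R).

(** The projection onto [[0, T]]. Composing with it extends a process to all times, so that joint
    measurability can be stated on the full product space. *)
Definition clamp T t : R := Num.max 0 (Num.min t T).

Lemma clamp_itv T t : 0 <= T -> clamp T t \in `[0, T].
Proof. by move=> T0; rewrite in_itv/= le_max lexx ge_max T0 ge_min lexx orbT. Qed.

Lemma clamp_id T t : t \in `[0, T] -> clamp T t = t.
Proof. by rewrite in_itv/= => /andP[t0 tT]; rewrite /clamp min_l// max_r. Qed.

Lemma measurable_clamp T : measurable_fun setT (clamp T).
Proof. by apply: measurable_maxr => //; exact: measurable_minr. Qed.

(** Clamping keeps the point in [[0, T]] for every [k], so that unions over the grid may run over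
    all natural numbers. *)
Definition grid_point T (n k : nat) : R := clamp T (k%:R / n.+1%:R).

Definition grid T (n : nat) t : R :=
  grid_point T n (Num.truncn (clamp T t * n.+1%:R)).

Lemma grid_dist T n t : 0 <= T -> `|clamp T t - grid T n t| < n.+1%:R^-1.
Proof.
move=> T0; have := clamp_itv t T0; rewrite in_itv/= => /andP[c0 cT].
have n0 : 0 < n.+1%:R :> R by rewrite ltr0n.
have cn0 : 0 <= clamp T t * n.+1%:R by rewrite mulr_ge0// ltW.
have /andP[k1 k2] := truncn_itv cn0.
have kc : (Num.truncn (clamp T t * n.+1%:R))%:R / n.+1%:R <= clamp T t.
  by rewrite ler_pdivrMr.
rewrite /grid /grid_point (clamp_id (t := _ / _)); last first.
  by rewrite in_itv/= (le_trans kc cT) andbT divr_ge0.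
rewrite ger0_norm ?subr_ge0// ltrBlDr -[X in X + _]mul1r -mulrDl ltr_pdivlMr//.
by rewrite addrC natr1.
Qed.

Lemma cvg_grid T t (f : R -> R) : 0 <= T -> {within `[0, T], continuous f} ->
  f (grid T n t) @[n --> \oo] --> f (clamp T t).
Proof.
move=> T0 /subspace_continuousP cf.
have tT := clamp_itv t T0.
apply: cvg_comp (cf _ tT) => A /nbhs_ballP[e /= e0 eA].
have : \forall n \near \oo, n.+1%:R^-1 < e by exact: near_infty_natSinv_lt (PosNum e0).
apply: filterS => n ne; apply: eA; last exact: clamp_itv.
by rewrite /ball/=; exact: lt_trans (grid_dist _ _ T0) ne.
Qed.

Context d (Omega : measurableType d).
Implicit Types X : R -> Omega -> R.

(** The process is constant in time on each of countably many cells, so a preimage is a countable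
    union of rectangles. *)
Lemma measurable_grid_process T X n : 0 <= T ->
  (forall t, t \in `[0, T] -> measurable_fun setT (X t)) ->
  measurable_fun setT (fun p : R * Omega => X (grid T n p.1) p.2).
Proof.
move=> T0 mX _ A mA; rewrite setTI.
rewrite [X in measurable X](_ : _ = \bigcup_k
  (((fun t => clamp T t * n.+1%:R) @^-1` `[k%:R, k.+1%:R[%classic) `*`
   (X (grid_point T n k) @^-1` A))); last first.
  have E t k : (Num.truncn (clamp T t * n.+1%:R) == k) =
      (k%:R <= clamp T t * n.+1%:R < k.+1%:R).
    have := clamp_itv t T0; rewrite in_itv/= => /andP[c0 _].
    by apply: truncn_eq; rewrite mulr_ge0.
  apply/seteqP; split => [[t w] /= At|[t w] [k _ [/=]]].
    exists (Num.truncn (clamp T t * n.+1%:R)) => //; split => //=.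
    by rewrite in_itv/= -E.
  by rewrite in_itv/= -E => /eqP <-.
apply: bigcupT_measurable => k; apply: measurableX.
  rewrite -[X in measurable X]setTI.
  by apply: measurable_funM => //; exact: measurable_clamp.
by rewrite -[X in measurable X]setTI; apply: mX => //; exact: clamp_itv.
Qed.

(** By path continuity the process is the pointwise limit of its discretizations on the grids. *)
Lemma measurable_continuous_process T X : 0 <= T ->
  (forall t, t \in `[0, T] -> measurable_fun setT (X t)) ->
  continuous_process T X ->
  measurable_fun setT (fun p : R * Omega => X (clamp T p.1) p.2).
Proof.
move=> T0 mX cX.
apply: (@measurable_fun_cvg _ _ _ _
  (fun n (p : R * Omega) => X (grid T n p.1) p.2)).
  by move=> n; exact: measurable_grid_process.
move=> [t w] _ /=; exact: (cvg_grid T0 (cX w)).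
Qed.

(** By continuity, a value above [delta] at some time forces one at some grid point, which turns the
    event into a countable union. *)
Lemma measurable_sup_process T X (delta : R) : 0 <= T ->
  (forall t, t \in `[0, T] -> measurable_fun setT (X t)) ->
  continuous_process T X ->
  measurable [set w | (delta%:E < ereal_sup [set (X t w)%:E | t in `[0%R, T]])%E].
Proof.
move=> T0 mX cX.
rewrite [X in measurable X](_ : _ = \bigcup_n \bigcup_k
  [set w | delta < X (grid_point T n k) w]).
  apply: bigcupT_measurable => n; apply: bigcupT_measurable => k.
  rewrite (_ : [set w | _] = X (grid_point T n k) @^-1` `]delta, +oo[%classic).
    by rewrite -[X in measurable X]setTI; apply: mX => //; exact: clamp_itv.
  by apply/seteqP; split => w /=; rewrite in_itv/= andbT.
apply/seteqP; split => w /=.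
  move=> /ereal_sup_gt[_ [t tT <-]]; rewrite lte_fin => dX.
  have := @cvg_grid T t _ T0 (cX w); rewrite clamp_id// => cg.
  have [n _ /(_ _ (leqnn n)) /= h] := cvgr_gt _ cg _ dX.
  by exists n => //; exists (Num.truncn (clamp T t * n.+1%:R)).
move=> [n _ [k _ /=]] dX.
apply: (@lt_le_trans _ _ (X (grid_point T n k) w)%:E); first by rewrite lte_fin.
apply: ereal_sup_ubound; exists (grid_point T n k) => //.
by apply: clamp_itv.
Qed.

End continuous_processes.

(** * Paths and energy of step processes *)

Section step_process_theory.
Context (R : realType) d (Omega : measurableType d).
Implicit Types (X : R -> Omega -> R) (T t s : R) (h : @step_process d Omega R).
Local Notation mu := (@lebesgue_measure R).

Lemma within_continuous_comp T (f g : R -> R) :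
  {within `[0, T], continuous f} -> continuous g ->
  (forall t, t \in `[0, T] -> g t \in `[0, T]) ->
  {within `[0, T], continuous (fun t => f (g t))}.
Proof.
move=> /subspace_continuousP cf cg gT; apply/subspace_continuousP => t tT.
apply: (@cvg_comp _ _ _ g f _ (within `[0, T]%classic (nbhs (g t))) _ _
  (cf _ (gT _ tT))) => A.
move=> hA; have := cg t (fun s => `[0, T]%classic s -> A s) hA.
rewrite nbhs_simpl/= => hg; apply: (filterS _ hg) => s /= As sT.
by apply: As; exact: gT.
Qed.

Lemma within_continuous_sp_integral T h X :
  (forall i, (i <= sp_size h)%N -> sp_time h i \in `[0, T]) ->
  continuous_process T X -> continuous_process T (sp_integral h X).
Proof.
move=> hT cX w.
have cXmin i : (i <= sp_size h)%N ->
    {within `[0, T], continuous (fun t => X (Num.min (sp_time h i) t) w)}.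
  move=> /hT; rewrite in_itv/= => /andP[i0 iT].
  apply: (@within_continuous_comp T (fun t => X t w)) (cX w) _ _.
    by move=> t; apply: (@continuous_min R R (cst (sp_time h i)) id t);
      [exact: cvg_cst|exact: cvg_id].
  by move=> t; rewrite !in_itv/= => /andP[t0 tT]; rewrite le_min i0 t0 ge_min iT.
apply/subspace_continuousP => t tT; rewrite /sp_integral.
apply: cvg_big => [|i _]; first exact: add_continuous.
apply: cvgM; first exact: cvg_cst.
have /subspace_continuousP c1 := @cXmin i.+1 (ltn_ord i).
have /subspace_continuousP c0 := @cXmin i (ltnW (ltn_ord i)).
by apply: cvgB; [exact: c1|exact: c0].
Qed.

(** The intervals of the steps are disjoint, so the cross terms vanish. *)
Lemma sp_value_sqr T (F : R -> set (set Omega)) h s w :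
  simple_process T F h ->
  sp_value h s w ^+ 2 = \sum_(i < sp_size h)
    sp_coef h i w ^+ 2 * \1_(`]sp_time h i, sp_time h i.+1]) s.
Proof.
move=> hs; rewrite /sp_value.
suff H k : (k <= sp_size h)%N ->
  (\sum_(i < k) sp_coef h i w * \1_(`]sp_time h i, sp_time h i.+1]) s) ^+ 2 =
  \sum_(i < k) sp_coef h i w ^+ 2 * \1_(`]sp_time h i, sp_time h i.+1]) s.
  exact: H.
elim: k => [_|k IH kn]; first by rewrite !big_ord0 expr0n.
rewrite !big_ord_recr/= sqrrD IH 1?ltnW//.
rewrite [\1_(`]sp_time h k, _]) s]indicE.
have [|_] := boolP (s \in _); last by rewrite !mulr0 mul0rn expr0n/= !addr0.
rewrite inE/= in_itv/= => /andP[ks _].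
have -> : \sum_(i < k) sp_coef h i w *
    \1_(`]sp_time h i, sp_time h i.+1]) s = 0.
  apply: big1 => i _; rewrite indicE memNset ?mulr0//= in_itv/= => /andP[_ si].
  have := simple_time_le hs (ltn_ord i) (ltnW kn).
  by rewrite leNgt (lt_le_trans ks si).
by rewrite mul0r mul0rn addr0 !mulr1.
Qed.

Lemma lebesgue_measure_itv_oc_setI (a b t : R) : 0 <= a -> a <= b ->
  mu (`]a, b] `&` `[0, t]) = (Num.min b t - Num.min a t)%:E.
Proof.
move=> a0 ab; have [ta|at_] := leP t a.
  rewrite [X in mu X](_ : _ = set0); last first.
    rewrite -subset0 => s /=; rewrite !in_itv/= => -[/andP[as_ _] /andP[_ st]].
    by have := lt_le_trans as_ (le_trans st ta); rewrite ltxx.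
  by rewrite measure0 min_r ?subrr// (le_trans ta).
rewrite [X in mu X](_ : _ = `]a, Num.min b t]%classic); last first.
  apply/seteqP; split => s /=; rewrite !in_itv/= le_min.
    by move=> [/andP[-> ->] /andP[_ ->]].
  by move=> /and3P[as_ -> ->]; rewrite as_ (le_trans a0)// ltW.
rewrite lebesgue_measure_itv/= lte_fin; case: ltP => // ba.
have : Num.min b t = a by apply/le_anti; rewrite ba le_min ab ltW.
by move=> ->; rewrite subrr.
Qed.

(** Identifies the sum in the compensator of [simple_exponent] as the energy of [h] up to time
    [t]. *)
Lemma integral_sp_value_sqr T (F : R -> set (set Omega)) h t w :
  simple_process T F h ->
  (\int[mu]_(s in `[0%R, t]) (sp_value h s w ^+ 2)%:E =
   (\sum_(i < sp_size h) sp_coef h i w ^+ 2 *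
      (Num.min (sp_time h i.+1) t - Num.min (sp_time h i) t))%:E)%E.
Proof.
move=> hs.
under eq_integral do rewrite (sp_value_sqr _ _ hs) -sumEFin.
rewrite ge0_integral_sum//; last 2 first.
- by move=> i; apply/measurable_EFinP; exact: measurable_funM.
- by move=> i s _; rewrite lee_fin mulr_ge0 ?sqr_ge0// indicE.
rewrite -sumEFin; apply: eq_bigr => i _.
under eq_integral do rewrite EFinM.
rewrite ge0_integralZl_EFin ?sqr_ge0//; last first.
  by apply/measurable_EFinP; exact: measurable_indic.
rewrite integral_indic// [RHS]EFinM. congr (_ * _)%E.
apply: lebesgue_measure_itv_oc_setI.
- apply: le_trans (sp_time_ge0 hs) _.
  by apply: simple_time_le hs _ _ => //; exact: ltnW.
- exact: (sp_time_nondecreasing hs).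
Qed.

Lemma measurable_sp_value h :
  (forall i, (i < sp_size h)%N -> measurable_fun setT (sp_coef h i)) ->
  measurable_fun setT (fun p : R * Omega => sp_value h p.1 p.2).
Proof.
move=> mh; apply: measurable_sum => i.
apply: measurable_funM.
  by apply: measurableT_comp => //; exact: mh.
exact: (@measurableT_comp _ _ _ _ _ _
  (\1_(`]sp_time h i, sp_time h i.+1]) : R -> R) _ fst).
Qed.

(** The domain becomes an indicator factor, after which this is the measurability part of Tonelli's
    theorem. *)
Lemma measurable_integral_fst (D : set R) (G : R * Omega -> \bar R) :
  measurable D -> measurable_fun setT G -> (forall p, (0 <= G p)%E) ->
  measurable_fun setT (fun w => (\int[mu]_(s in D) G (s, w))%E).
Proof.
move=> mD mG G0.
pose f (p : R * Omega) := (G p * (\1_D p.1)%:E)%E.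
have mf : measurable_fun setT f.
  apply: emeasurable_funM => //; apply/measurable_EFinP.
  apply: (@measurableT_comp _ _ _ _ _ _ (\1_D : R -> R) _ fst) => //.
have f0 p : (0 <= f p)%E by rewrite mule_ge0// lee_fin.
rewrite [X in measurable_fun _ X](_ : _ = fubini_G mu f).
  exact: measurable_fun_fubini_tonelli_G.
apply/funext => w; rewrite /fubini_G [LHS]integral_mkcond; apply: eq_integral => s _.
by rewrite patchE /f/= indicE; case: ifPn => _; rewrite ?mule1 ?mule0.
Qed.

End step_process_theory.

(** * Exponential moments of the CIR process *)

Section exponential_bound.
Context d (Omega : measurableType d) (R : realType).
Variable P : probability Omega R.
Local Notation mu := (@lebesgue_measure R).

(** With [Y] truncated at [N], the exceptional event adds at most [N * P (Bn n)], which vanishes as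
    [n] grows. Monotone convergence in [N] then removes the truncation. *)
Lemma le_integral_small_exceptions (C : R) (Y : Omega -> R)
    (Yn : nat -> Omega -> R) (Bn : nat -> set Omega) :
  measurable_fun setT Y -> (forall w, 0 <= Y w) -> 0 <= C ->
  (forall n, measurable_fun setT (Yn n)) -> (forall n w, 0 <= Yn n w) ->
  (forall n, (\int[P]_w (Yn n w)%:E <= 1)%E) ->
  (forall n, measurable (Bn n)) -> P (Bn n) @[n --> \oo] --> 0%E ->
  (forall n w, ~ Bn n w -> Y w <= C * Yn n w) ->
  (\int[P]_w (Y w)%:E <= C%:E)%E.
Proof.
move=> mY Y0 C0 mYn Yn0 Yn1 mB PB YC.
have trunc (N : nat) : (\int[P]_w (Num.min (Y w) N%:R)%:E <= C%:E)%E.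
  have le n : (\int[P]_w (Num.min (Y w) N%:R)%:E <= C%:E + N%:R%:E * P (Bn n))%E.
    apply: (@le_trans _ _ (\int[P]_w ((C * Yn n w)%:E + (N%:R * \1_(Bn n) w)%:E))%E).
      apply: ge0_le_integral => //.
      - by move=> w _; rewrite lee_fin le_min Y0 ler0n.
      - by apply/measurable_EFinP; exact: measurable_minr.
      - apply: emeasurable_funD; apply/measurable_EFinP.
          exact: measurable_funM.
        apply: measurable_funM; first exact: measurable_cst.
        exact: measurable_indic.
      - move=> w _; rewrite -EFinD lee_fin indicE.
        have [wB|wB] := boolP (w \in Bn n).
          by rewrite mulr1 ge_min lerDr mulr_ge0 ?orbT.
        rewrite mulr0 addr0 ge_min YC// => Bw.
        by move: wB; rewrite mem_set.
    rewrite ge0_integralD//; last 3 first.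
    - by move=> w _; rewrite lee_fin mulr_ge0.
    - by apply/measurable_EFinP; exact: measurable_funM.
    - by apply/measurable_EFinP; exact: measurable_funM.
    apply: leeD.
      under eq_integral do rewrite EFinM.
      rewrite ge0_integralZl_EFin//; last 2 first.
      - by move=> w _; rewrite lee_fin.
      - exact/measurable_EFinP.
      by rewrite -[X in (_ <= X)%E]mule1; apply: lee_wpmul2l => //; rewrite lee_fin.
    under eq_integral do rewrite EFinM.
    rewrite ge0_integralZl_EFin//; last first.
      by apply/measurable_EFinP; exact: measurable_indic.
    by rewrite integral_indic// setIT.
  have cv : (C%:E + N%:R%:E * P (Bn n))%E @[n --> \oo] --> C%:E.
    rewrite -[X in _ --> X]adde0 -[X in _ --> (_ + X)%E](mule0 N%:R%:E).
    by apply: cvgeD => //; [exact: cvg_cst|exact: cvgeZl].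
  by apply: (cvge_ge _ cv); exact: nearW.
have lim w : limn (fun N : nat => (Num.min (Y w) N%:R)%:E) = (Y w)%:E.
  apply: cvg_lim => //; apply: cvg_near_cst.
  exists (Num.truncn (Y w)).+1 => // N /= YN; rewrite min_l//.
  by apply/ltW/(lt_le_trans (truncnS_gt _)); rewrite ler_nat.
under eq_integral do rewrite -lim.
have cv : (\int[P]_w (Num.min (Y w) N%:R)%:E @[N --> \oo] -->
    \int[P]_w limn (fun N : nat => (Num.min (Y w) N%:R)%:E))%E.
  apply: cvg_monotone_convergence => //.
  - by move=> N; apply/measurable_EFinP; exact: measurable_minr.
  - by move=> N w _; rewrite lee_fin le_min Y0 ler0n.
  - by move=> w _ m n mn; rewrite lee_fin le_min ge_min lexx/= ge_min ler_nat mn orbT.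
by apply: (cvge_le _ cv); exact: nearW.
Qed.

Lemma simple_exponentE (lam : R) (h : @step_process d Omega R)
    (X : R -> Omega -> R) (t : R) (w : Omega) :
  simple_exponent lam h X t (sp_size h) w = lam * sp_integral h X t w
    - lam ^+ 2 / 2 * \sum_(i < sp_size h) sp_coef h i w ^+ 2 *
        (Num.min (sp_time h i.+1) t - Num.min (sp_time h i) t).
Proof. by rewrite /simple_exponent sumrB -!mulr_sumr. Qed.

Lemma measurable_sqrtr : measurable_fun setT (@Num.sqrt R).
Proof. by apply: continuous_measurable_fun; exact: sqrt_continuous. Qed.

(** With [a] the step value and [b] the root of [V], [a ^+ 2 <= 2 * b ^+ 2 + 2 * (a - b) ^+ 2], the
    difference being the square of [a - 2 * b]. The last term integrates to at most 2. *)
Lemma energy_bound (T t : R) (h : @step_process d Omega R)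
    (F : R -> set (set Omega)) (V : R -> Omega -> R) (w : Omega) :
  simple_process T F h ->
  (forall i, (i < sp_size h)%N -> measurable_fun setT (sp_coef h i)) ->
  t \in `[0, T] ->
  {within `[0, T], continuous (fun s => V s w)} ->
  (forall s, s \in `[0, T] -> 0 <= V s w) ->
  (\int[mu]_(s in `[0%R, T])
     ((sp_value h s w - Num.sqrt (V s w)) ^+ 2)%:E <= 1)%E ->
  \sum_(i < sp_size h) sp_coef h i w ^+ 2 *
        (Num.min (sp_time h i.+1) t - Num.min (sp_time h i) t)
  <= 2 * \int[mu]_(s in `[0, t]) V s w + 2.
Proof.
move=> hs mh tT cV V0 D1.
have mV : measurable_fun `[0, T] (fun s => V s w).
  exact: subspace_continuous_measurable_fun.
have tT' : `[0, t]%classic `<=` `[0, T]%classic.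
  move: tT; rewrite in_itv/= => /andP[_ tT] s /=.
  by rewrite !in_itv/= => /andP[-> st]; exact: le_trans tT.
have msp : measurable_fun setT (fun s => sp_value h s w).
  apply: (@measurableT_comp _ _ _ _ _ _
    (fun p : R * Omega => sp_value h p.1 p.2) _ (fun s => (s, w))).
    exact: measurable_sp_value.
  exact: pair2_measurable.
have mG : measurable_fun `[0, T]
    (fun s => ((sp_value h s w - Num.sqrt (V s w)) ^+ 2)%:E).
  apply/measurable_EFinP; apply: measurable_funX; apply: measurable_funB.
    exact: measurable_funTS.
  by apply: measurableT_comp; [exact: measurable_sqrtr|].
have iV : mu.-integrable `[0, t] (EFin \o (fun s => V s w)).
  apply: continuous_compact_integrable; first exact: segment_compact.
  exact: continuous_subspaceW tT' cV.
(* A real-valued integral is 0 when the extended one is infinite; continuity on a compact interval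
   excludes that case. *)
have JE : (\int[mu]_(s in `[0%R, t]) (V s w)%:E =
    (\int[mu]_(s in `[0, t]) V s w)%:E)%E.
  by rewrite /Rintegral fineK//; exact: integrable_fin_num.
rewrite -lee_fin -(integral_sp_value_sqr t w hs) EFinD EFinM -JE.
apply: (@le_trans _ _ (\int[mu]_(s in `[0%R, t])
  (2%:E * (V s w)%:E + 2%:E * ((sp_value h s w - Num.sqrt (V s w)) ^+ 2)%:E))%E).
  apply: le_integral_nomeas => s st; first by rewrite lee_fin sqr_ge0.
  rewrite -!EFinM -EFinD lee_fin.
  have Vs : 0 <= V s w by apply: V0; exact: tT'.
  rewrite -{1}(sqr_sqrtr Vs) -subr_ge0.
  set a := sp_value _ _ _; set b := Num.sqrt _.
  by rewrite (_ : _ - _ = (a - 2 * b) ^+ 2) ?sqr_ge0//; ring.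
have mVt : measurable_fun `[0, t] (fun s => (V s w)%:E).
  by apply/measurable_EFinP; exact: measurable_funS mV.
have mGt := measurable_funS (measurable_itv _) tT' mG.
have V0t s : s \in `[0, t] -> (0 <= (V s w)%:E)%E.
  by move=> st; rewrite lee_fin; apply: V0; exact: tT'.
rewrite ge0_integralD//; last 4 first.
- by move=> s st; rewrite mule_ge0// V0t.
- exact: measurable_funeM.
- by move=> s _; rewrite mule_ge0// lee_fin sqr_ge0.
- exact: measurable_funeM.
rewrite !ge0_integralZl_EFin//; last by move=> s _; rewrite lee_fin sqr_ge0.
apply: leeD => //; rewrite -[X in (_ <= X)%E]mule1; apply: lee_wpmul2l => //.
apply: le_trans D1; apply: ge0_subset_integral => //.
by move=> s _; rewrite lee_fin sqr_ge0.
Qed.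

Lemma brownian_filtration_measurable (T : R) (X : R -> Omega -> R) t :
  brownian_motion P T X -> t \in `[0, T] ->
  augmented_filtration P X t `<=` measurable.
Proof.
move=> BX; rewrite in_itv/= => /andP[t0 tT].
apply: augmented_filtration_measurable => u.
rewrite in_itv/= => /andP[u0 ut]; apply: (bm_measurable BX).
by rewrite in_itv/= u0 (le_trans ut).
Qed.

Lemma adapted_measurable (T : R) (X Y : R -> Omega -> R) t :
  brownian_motion P T X -> adapted T (augmented_filtration P X) Y ->
  t \in `[0, T] -> measurable_fun setT (Y t).
Proof.
move=> BX aY tT _ A mA; rewrite setTI.
by apply: (brownian_filtration_measurable BX tT); exact: aY.
Qed.

(** The clamped process is jointly measurable and agrees with [V] on [[0, t]]. *)
Lemma measurable_Rintegral_process (T : R) (V : R -> Omega -> R) t :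
  (forall s, s \in `[0, T] -> measurable_fun setT (V s)) ->
  continuous_process T V -> (forall s w, s \in `[0, T] -> 0 <= V s w) ->
  t \in `[0, T] ->
  measurable_fun setT (fun w => \int[mu]_(s in `[0, t]) V s w).
Proof.
move=> mV cV V0 tT.
have T0 : 0 <= T by move: tT; rewrite in_itv/= => /andP[]; exact: le_trans.
apply: measurableT_comp; first exact: fine_measurable.
pose G (p : R * Omega) := (V (clamp T p.1) p.2)%:E.
rewrite (_ : (fun w => _) = fun w => (\int[mu]_(s in `[0%R, t]) G (s, w))%E).
  apply: measurable_integral_fst => //.
    by apply/measurable_EFinP; exact: measurable_continuous_process.
  by move=> p; rewrite lee_fin; apply: V0; exact: clamp_itv.
apply/funext => w; apply: eq_integral => s; rewrite inE/= => st.
rewrite /G/= clamp_id//; move: st tT; rewrite !in_itv/= => /andP[-> st] /andP[_].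
exact: le_trans.
Qed.

(** The approximating simple processes have exponentials of mean 1, and
    [le_integral_small_exceptions] carries this to [I]. The exceptional events are those where the
    squared [L^2] error or the uniform error exceeds 1. The compensator [lam ^+ 2], twice the usual
    one, pays for the factor 2 in [energy_bound]. *)
Lemma ito_exponential_bound (T lam : R) (X V I : R -> Omega -> R) (t : R) :
  brownian_motion P T X ->
  (forall s, s \in `[0, T] -> measurable_fun setT (V s)) ->
  continuous_process T V -> (forall s w, s \in `[0, T] -> 0 <= V s w) ->
  is_ito_integral P T (augmented_filtration P X) X
    (fun s w => Num.sqrt (V s w)) I ->
  0 <= lam -> t \in `[0, T] ->
  (\int[P]_w (expR (lam * I t w - lam ^+ 2 * \int[mu]_(s in `[0, t]) V s w))%:E
   <= (expR (lam + lam ^+ 2))%:E)%E.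
Proof.
move=> BX mV cV V0 [_ _ aI cI [h [hs hD hS]]] lam0 tT.
have T0 : 0 <= T by move: tT; rewrite in_itv/= => /andP[]; exact: le_trans.
have mX s : s \in `[0, T] -> measurable_fun setT (X s).
  by move=> sT; exact: (bm_measurable BX).
have Fm s : s \in `[0, T] -> augmented_filtration P X s `<=` measurable.
  by move=> sT; exact: brownian_filtration_measurable BX sT.
have mI s : s \in `[0, T] -> measurable_fun setT (I s).
  by move=> sT; exact: adapted_measurable BX aI sT.
have hT n i : (i <= sp_size (h n))%N -> sp_time (h n) i \in `[0, T].
  move=> i_n; rewrite in_itv/=; apply/andP; split.
    by apply: le_trans (sp_time_ge0 (hs n)) _; exact: simple_time_le (hs n) _ _.
  by apply: le_trans _ (sp_time_le (hs n)); exact: simple_time_le (hs n) _ _.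
have mh n i : (i < sp_size (h n))%N -> measurable_fun setT (sp_coef (h n) i).
  move=> i_n _ A mA; rewrite setTI; apply: (Fm _ (hT _ _ (ltnW i_n))).
  exact: (sp_coef_measurable (hs n)).
have mhX n s : s \in `[0, T] -> measurable_fun setT (sp_integral (h n) X s).
  move=> sT; apply: measurable_sum => i.
  have minT j : (j <= sp_size (h n))%N -> Num.min (sp_time (h n) j) s \in `[0, T].
    move=> /hT; move: sT; rewrite !in_itv/= => /andP[s0 sT] /andP[j0 jT].
    by rewrite le_min j0 s0 ge_min jT.
  apply: measurable_funM; first exact: mh.
  by apply: measurable_funB; apply: mX; apply: minT => //; exact: ltnW.
pose Dn n w := (\int[mu]_(s in `[0%R, T])
  ((sp_value (h n) s w - Num.sqrt (V s w)) ^+ 2)%:E)%E.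
pose Sn n w := ereal_sup [set (`|sp_integral (h n) X s w - I s w|%:E)%E
                    | s in `[0, T]].
have mDn n : measurable_fun setT (Dn n).
  pose G (p : R * Omega) :=
    ((sp_value (h n) p.1 p.2 - Num.sqrt (V (clamp T p.1) p.2)) ^+ 2)%:E.
  rewrite (_ : Dn n = fun w => (\int[mu]_(s in `[0%R, T]) G (s, w))%E).
    apply: measurable_integral_fst => //; last first.
      by move=> p; rewrite lee_fin sqr_ge0.
    apply/measurable_EFinP; apply: measurable_funX; apply: measurable_funB.
      by apply: measurable_sp_value; exact: mh.
    apply: measurableT_comp; first exact: measurable_sqrtr.
    exact: measurable_continuous_process.
  apply/funext => w; apply: eq_integral => s; rewrite inE/= => sT.
  by rewrite /G/= clamp_id.
have mB1 n : measurable [set w | (1%:E < Dn n w)%E].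
  by rewrite -[X in measurable X]setTI; exact: emeasurable_fun_o_infty.
have mB2 n : measurable [set w | (1%:E < Sn n w)%E].
  apply: (@measurable_sup_process _ _ _ T
    (fun s w => `|sp_integral (h n) X s w - I s w|)) => // [s sT|w].
    by apply: measurableT_comp => //; apply: measurable_funB; [exact: mhX|exact: mI].
  have /subspace_continuousP c1 :=
    within_continuous_sp_integral (hT n) (bm_continuous BX) (w := w).
  have /subspace_continuousP c2 := cI w.
  apply/subspace_continuousP => s sT; apply: cvg_norm.
  by apply: cvgB; [exact: c1|exact: c2].
have mJ : measurable_fun setT (fun w => \int[mu]_(s in `[0, t]) V s w).
  exact: measurable_Rintegral_process mV cV V0 tT.
apply: (@le_integral_small_exceptions _ _
  (fun n w => expR (simple_exponent lam (h n) X t (sp_size (h n)) w))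
  (fun n => [set w | (1%:E < Dn n w)%E] `|` [set w | (1%:E < Sn n w)%E])).
- apply: measurableT_comp => //; apply: measurable_funB.
    by apply: measurable_funM => //; exact: mI.
  exact: measurable_funM.
- by move=> w; exact: expR_ge0.
- exact: expR_ge0.
- move=> n; apply: measurableT_comp => //.
  rewrite (funext (simple_exponentE lam (h n) X t)).
  apply: measurable_funB; first by apply: measurable_funM => //; exact: mhX.
  apply: measurable_funM => //; apply: measurable_sum => i.
  apply: measurable_funM => //.
  by apply: measurable_funX; exact: mh.
- by move=> n w; exact: expR_ge0.
- by move=> n; rewrite (integral_expR_simple_exponent lam BX tT (hs n)).
- by move=> n; exact: measurableU.
- apply: (@squeeze_cvge _ _ _ _ (cst 0%E) _
    (fun n => P [set w | (1%:E < Dn n w)%E] + P [set w | (1%:E < Sn n w)%E])%E).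
  + apply: nearW => n; rewrite measure_ge0/=; exact: measureU2.
  + exact: cvg_cst.
  + rewrite -[X in _ --> X]adde0; apply: cvgeD => //.
      exact: (hD 1 ltr01).
    exact: (hS 1 ltr01).
- move=> n w /not_orP[/negP]; rewrite -leNgt => D1 /negP; rewrite -leNgt => S1.
  (* Replacing the simple integral by [I] costs [lam]; the additive 2 of [energy_bound] costs
     [lam ^+ 2]. Together they are the exponent of the bound. *)
  rewrite -expRD ler_expR simple_exponentE.
  have := @energy_bound T t (h n) _ V w (hs n) (@mh n) tT (cV w) (V0 ^~ w) D1.
  set Q := \sum_(i < _) _; set J := Rintegral _ _ _ => QJ.
  have : `|sp_integral (h n) X t w - I t w| <= 1.
    rewrite -lee_fin; apply: le_trans S1; apply: ereal_sup_ubound.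
    by exists t.
  rewrite ler_norml => /andP[SI _].
  have : lam * (I t w - sp_integral (h n) X t w) <= lam * 1.
    by apply: ler_wpM2l => //; lra.
  have : lam ^+ 2 / 2 * Q <= lam ^+ 2 / 2 * (2 * J + 2).
    by apply: ler_wpM2l => //; rewrite divr_ge0// sqr_ge0.
  lra.
Qed.

End exponential_bound.

(** * From the Itô integral to the CIR process *)

Section cir_moments.
Context d (Omega : measurableType d) (R : realType).
Variable P : probability Omega R.
Local Notation mu := (@lebesgue_measure R).

(** The mean reversion contributes [- c * kappa] times the integral of [V], which by the assumption
    on [c * vol] is at least as negative as the compensator in [ito_exponential_bound]. Bounding [t]
    by [T] makes the estimate uniform in time. *)
Lemma cir_exponential_moment (T kappa theta vol v0 c : R)
    (B V : R -> Omega -> R) (t : R) :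
  brownian_motion P T B -> cir_solution P T kappa theta vol v0 B V ->
  0 <= kappa -> 0 <= theta -> 0 <= vol -> 0 <= c ->
  (c * vol) ^+ 2 <= c * kappa -> t \in `[0, T] ->
  (\int[P]_w (expR (c * V t w))%:E <=
   (expR (c * v0 + c * kappa * theta * T + c * vol + (c * vol) ^+ 2))%:E)%E.
Proof.
move=> BB [aV cV V0 [I II VE]] kappa0 theta0 vol0 c0 cvk tT.
have V0' s w : s \in `[0, T] -> 0 <= V s w by move=> sT; exact: V0.
have mV s : s \in `[0, T] -> measurable_fun setT (V s).
  by move=> sT; exact: adapted_measurable BB aV sT.
have mI : measurable_fun setT (I t).
  by case: II => _ _ aI _ _; exact: adapted_measurable BB aI tT.
have mJ := measurable_Rintegral_process mV cV V0' tT.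
have lam0 : 0 <= c * vol by rewrite mulr_ge0.
have bound := ito_exponential_bound BB mV cV V0' II lam0 tT.
set J := fun w => \int[mu]_(s in `[0, t]) V s w in mJ.
pose e := expR (c * v0 + c * kappa * theta * T).
have mE : measurable_fun setT
    (fun w => (expR (c * vol * I t w - (c * vol) ^+ 2 * J w))%:E).
  apply/measurable_EFinP; apply: measurableT_comp => //; apply: measurable_funB.
    exact: measurable_funM.
  exact: measurable_funM.
have t0 : 0 <= t by move: tT; rewrite in_itv/= => /andP[].
have tT' : t <= T by move: tT; rewrite in_itv/= => /andP[].
apply: (@le_trans _ _ (\int[P]_w (e%:E *
    (expR (c * vol * I t w - (c * vol) ^+ 2 * J w))%:E))%E).
  (* The equation for [V] holds only almost surely, hence an almost everywhere comparison. *)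
  apply: ae_ge0_le_integral => //.
  - by apply/measurable_EFinP; apply: measurableT_comp => //;
      apply: measurable_funM => //; exact: mV.
  - by move=> w _; rewrite -EFinM lee_fin mulr_ge0 ?expR_ge0.
  - exact: measurable_funeM.
  - apply: filterS VE => w /(_ t tT) VEt _.
    rewrite -EFinM lee_fin /e -expRD ler_expR VEt.
    have iV : mu.-integrable `[0, t] (EFin \o (fun s => V s w)).
      apply: continuous_compact_integrable; first exact: segment_compact.
      apply: continuous_subspaceW (cV w) => s /=; rewrite !in_itv/= => /andP[-> st].
      exact: le_trans tT'.
    have J0 : 0 <= J w.
      apply: Rintegral_ge0 => s /=; rewrite in_itv/= => /andP[s0 st].
      by apply: V0; rewrite in_itv/= s0 (le_trans st).
    have icst : mu.-integrable `[0, t] (EFin \o (fun=> theta)).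
      apply: continuous_compact_integrable; first exact: segment_compact.
      exact: cst_continuous.
    have -> : \int[mu]_(s in `[0, t]) (kappa * (theta - V s w)) =
        kappa * (theta * t - J w).
      rewrite RintegralZl//; last exact: (integrableB _ icst iV).
      rewrite RintegralB// Rintegral_cst//= lebesgue_measure_itv/= lte_fin.
      (* The measure of the interval is given by cases; at [t = 0] the default value 0 is the right
         one. *)
      have -> // : fine (if 0 < t then (t%:E + (- 0)%R%:E)%E else 0%E) = t.
      by have [_|t0'] := ltP 0 t; rewrite /= ?subr0//; apply/le_anti/andP.
    have h1 : (c * vol) ^+ 2 * J w <= c * kappa * J w by exact: ler_wpM2r.
    have h2 : c * kappa * theta * t <= c * kappa * theta * T.
      by apply: ler_wpM2l => //; rewrite !mulr_ge0.
    lra.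
rewrite ge0_integralZl_EFin ?expR_ge0//.
apply: le_trans (lee_wpmul2l _ bound) _; first by rewrite lee_fin expR_ge0.
by rewrite -EFinM lee_fin /e -expRD ler_expR !addrA.
Qed.

End cir_moments.

(** * The Volterra process *)

(* The library's canonical [SigmaFiniteMeasure] instance for [\x] is keyed on
   subprobabilities, so the one for the planar Lebesgue measure is packed by
   hand below. *)
Lemma sigma_finite_lebesgue2 (R : realType) :
  sigma_finite setT (@lebesgue_measure R \x @lebesgue_measure R)%E.
Proof.
exists (fun n => `[- n%:R, n%:R] `*` `[- n%:R, n%:R]); last first.
  move=> n; split; first exact: measurableX.
  rewrite product_measure1E//= lebesgue_measure_itv/= lte_fin.
  by case: ifPn => _; rewrite ?mule0 ?ltry// -!EFinD -EFinM ltry.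
apply/seteqP; split => // -[y z] _; exists (Num.truncn (Num.max `|y| `|z|)).+1 => //=.
have := ltW (truncnS_gt (Num.max `|y| `|z|)).
by rewrite ge_max !in_itv/= -!ler_norml => /andP[].
Qed.

Definition lebesgue_measure2 (R : realType) :
    {sigma_finite_measure
       set (measurableTypeR R * measurableTypeR R)%type -> \bar R} :=
  HB.pack (@lebesgue_measure R \x @lebesgue_measure R)%E
    (Measure_isSigmaFinite.Build _ _ _ (@lebesgue_measure R \x @lebesgue_measure R)%E
      (@sigma_finite_lebesgue2 R)).

Section volterra_bound.
Context (R : realType).
Variables (T : R) (K : R -> R -> R).
Local Notation mu := (@lebesgue_measure R).
Local Notation square := (`[0, T]%classic `*` `[0, T]%classic : set (R * R)).
Hypothesis T_gt0 : 0 < T.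
Hypothesis K_admissible : admissible_volterra_kernel T K.
Hypothesis K_ge0 : forall t s : R, t \in `[0, T] -> s \in `[0, T] -> 0 <= K t s.

(* The summand 1 gives the kernel positive mass and dominates the constant
   [x] of the Volterra process. *)
Definition shifted_kernel : R * R -> R := (fun p => K p.1 p.2 + 1) \_ square.

Let K1_ge0 (p : R * R) : square p -> 0 <= K p.1 p.2 + 1.
Proof. by move=> -[? ?]; rewrite addr_ge0// K_ge0. Qed.

Lemma shifted_kernel_ge0 p : 0 <= shifted_kernel p.
Proof. by rewrite /shifted_kernel patchE; case: ifPn => // /set_mem /K1_ge0. Qed.

Let msquare : measurable square.
Proof. exact: measurableX. Qed.

Lemma measurable_shifted_kernel : measurable_fun setT shifted_kernel.
Proof.
apply/(measurable_restrictT _ _).1 => //.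
by apply: measurable_funD => //; exact: avk_measurable K_admissible.
Qed.

(** Finite because [K + 1 <= 2 + K ^+ 2] and the kernel is square integrable on a square of finite
    measure; positive because the summand 1 alone contributes [T * T]. *)
Lemma integral_shifted_kernel : exists2 a : R, 0 < a &
  (\int[(mu \x mu)%E]_p (shifted_kernel p)%:E = a%:E)%E.
Proof.
have mK : measurable_fun square (fun p => K p.1 p.2) := avk_measurable K_admissible.
have E : (\int[(mu \x mu)%E]_p (shifted_kernel p)%:E =
    \int[(mu \x mu)%E]_(p in square) (K p.1 p.2 + 1)%:E)%E.
  by rewrite [RHS]integral_mkcond restrict_EFin.
have musq : (mu \x mu)%E square = (T * T)%:E.
  by rewrite product_measure1E//= lebesgue_measure_itv/= lte_fin T_gt0 -!EFinD subr0.
have mK1 : measurable_fun square (fun p => (K p.1 p.2 + 1)%:E).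
  by apply/measurable_EFinP; exact: measurable_funD.
have ub : (\int[(mu \x mu)%E]_p (shifted_kernel p)%:E < +oo)%E.
  rewrite E; apply: (@le_lt_trans _ _
    (\int[(mu \x mu)%E]_(p in square) (cst 2%:E p + ((K p.1 p.2) ^+ 2)%:E))%E).
    apply: le_integral_nomeas => p sp; first by rewrite lee_fin K1_ge0.
    rewrite -EFinD lee_fin -subr_ge0.
    rewrite (_ : _ - _ = (K p.1 p.2 - 2^-1) ^+ 2 + 3 / 4); last by field.
    by rewrite addr_ge0 ?sqr_ge0// divr_ge0.
  rewrite ge0_integralD//; last 3 first.
  - by move=> p _; rewrite lee_fin.
  - by move=> p _; rewrite lee_fin sqr_ge0.
  - by apply/measurable_EFinP; exact: measurable_funX.
  apply: lte_add_pinfty; last exact: avk_square_integrable K_admissible.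
  have i2 : (\int[(mu \x mu)%E]_(p in square) cst 2%:E p = 2%:E * (T * T)%:E)%E.
    by rewrite -musq; exact: integral_cst.
  by rewrite [X in (X < _)%E]i2 -EFinM ltry.
have lb : ((T * T)%:E <= \int[(mu \x mu)%E]_p (shifted_kernel p)%:E)%E.
  rewrite E -musq -[leLHS]mul1e.
  have <- : (\int[(mu \x mu)%E]_(p in square) cst 1 p = 1 * (mu \x mu) square)%E.
    exact: integral_cst.
  apply: le_integral_nomeas => p sp; first by rewrite lee_fin.
  by rewrite lee_fin lerDr; case: sp => ? ?; exact: K_ge0.
exists (fine (\int[(mu \x mu)%E]_p (shifted_kernel p)%:E)%E).
  apply: fine_gt0; rewrite ub andbT; apply: lt_le_trans lb.
  by rewrite lte_fin mulr_gt0.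
rewrite fineK// ge0_fin_numE//; apply: integral_ge0 => p _.
by rewrite lee_fin shifted_kernel_ge0.
Qed.

Variable (x : R).
Hypothesis x_ge0 : 0 <= x.

(** The constant [x] is spread over [[0, T]] as [x / T], and [x / T + K t s * v s <= (K t s + 1) *
    (v s + x / T)] since all factors are nonnegative. *)
Lemma le_shifted_kernel (v : R -> R) (t : R) :
  {within `[0, T], continuous v} -> (forall s, s \in `[0, T] -> 0 <= v s) ->
  t \in `[0, T] ->
  ((x + \int[mu]_(s in `[0, t]) (K t s * v s))%:E <=
   \int[mu]_s (shifted_kernel (t, s) * (v (clamp T s) + x / T))%:E)%E.
Proof.
move=> cv v0 tT.
have t_T : t <= T by move: tT; rewrite in_itv/= => /andP[].
have sub s : s \in `[0, t] -> s \in `[0, T].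
  by rewrite !in_itv/= => /andP[-> st]; exact: le_trans t_T.
have mv : measurable_fun `[0, T] v by exact: subspace_continuous_measurable_fun.
(* Obtained as a section of the jointly measurable kernel, which also covers [t = 0], where
   admissibility does not speak of the slice. *)
have mKt : measurable_fun `[0, T] (K t).
  apply: (eq_measurable_fun (fun s => shifted_kernel (t, s) - 1)).
    move=> s /set_mem sT; rewrite /shifted_kernel patchE mem_set//=.
    by rewrite addrK.
  apply: measurable_funTS; apply: measurable_funB => //.
  apply: (@measurableT_comp _ _ _ _ _ _ shifted_kernel _ (pair t)).
    exact: measurable_shifted_kernel.
  exact: pair1_measurable.
have Kv0 s : s \in `[0, T] -> 0 <= K t s * v s.
  by move=> sT; rewrite mulr_ge0 ?K_ge0 ?v0.
set J := (\int[mu]_(s in `[0%R, T]) (K t s * v s)%:E)%E.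
(* Were the extended integral infinite, its real counterpart would be 0 and the inequality would
   still hold. *)
have RJ : ((\int[mu]_(s in `[0, t]) (K t s * v s))%:E <= J)%E.
  apply: (@le_trans _ _ (\int[mu]_(s in `[0%R, t]) (K t s * v s)%:E)%E).
    rewrite /Rintegral; have := @integral_ge0 _ _ _ mu `[0%R, t]%classic
      (fun s => (K t s * v s)%:E) (fun s st => Kv0 s (sub s st)).
    by case: (\int[mu]_(s in _) _)%E => [r|_|]//=; rewrite leey.
  apply: ge0_subset_integral => //.
  by apply/measurable_EFinP; exact: measurable_funM.
have xE : x%:E = (\int[mu]_(s in `[0%R, T]) (cst (x / T)%:E s))%E.
  rewrite integral_cst//= lebesgue_measure_itv/= lte_fin T_gt0 -EFinD subr0 -EFinM.
  by rewrite divfK// gt_eqF.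
have xT0 : 0 <= x / T by rewrite divr_ge0// ltW.
apply: (@le_trans _ _ (\int[mu]_(s in `[0%R, T])
  (cst (x / T)%:E s + (K t s * v s)%:E))%E).
  rewrite ge0_integralD//; last first.
    by apply/measurable_EFinP; exact: measurable_funM.
  by rewrite -xE EFinD leeD2l.
rewrite integral_mkcond; apply: le_integral_nomeas => s _.
  by apply: erestrict_ge0 => u uT; rewrite adde_ge0// lee_fin Kv0.
rewrite /shifted_kernel !patchE; case: ifPn => [/set_mem/= sT|_]; last first.
  by rewrite lee_fin mulr_ge0 ?shifted_kernel_ge0// addr_ge0// v0// clamp_itv// ltW.
rewrite mem_set//= clamp_id// -EFinD lee_fin.
have := K_ge0 tT sT; have := v0 s sT; nra.
Qed.

Context d (Omega : measurableType d).
Variable P : probability Omega R.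

(** An application of [ge0_expeR_integral_le] on the time plane, with [f] depending only on the
    inner time. Jensen multiplies the exponent by the mass [a], hence the moments of order
    [a * alpha]; the summand [x / T] yields the constant factor. *)
Lemma volterra_exponential_moment (alpha a M : R) (V : R -> Omega -> R) :
  0 < alpha -> 0 < a ->
  (\int[(mu \x mu)%E]_p (shifted_kernel p)%:E = a%:E)%E ->
  (forall s, s \in `[0, T] -> measurable_fun setT (V s)) ->
  continuous_process T V -> (forall s w, s \in `[0, T] -> 0 <= V s w) ->
  (forall s, s \in `[0, T] ->
     (\int[P]_w (expR (a * alpha * V s w))%:E <= M%:E)%E) ->
  (exponential_moment P T alpha id (volterra_process K x V) <=
   (expR (a * alpha * (x / T)) * M)%:E)%E.
Proof.
move=> alpha0 a0 aE mV cV V0 VM.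
have T0 : 0 <= T by exact: ltW.
have xT0 : 0 <= x / T by rewrite divr_ge0.
pose C := expR (a * alpha * (x / T)).
pose f (q : Omega * (measurableTypeR R * measurableTypeR R)) :=
  alpha * (V (clamp T q.2.2) q.1 + x / T).
have Vx0 w t : 0 <= V (clamp T t) w + x / T.
  by rewrite addr_ge0// V0// clamp_itv.
have mVc : measurable_fun setT
    (fun q : Omega * (measurableTypeR R * measurableTypeR R) =>
       V (clamp T q.2.2) q.1).
  apply: (@measurableT_comp _ _ _ _ _ _
    (fun p : measurableTypeR R * Omega => V (clamp T p.1) p.2) _
    (fun q : Omega * (measurableTypeR R * measurableTypeR R) => (q.2.2, q.1))).
    exact: measurable_continuous_process.
  apply: measurable_fun_pair => //.
  exact: measurableT_comp.
have mf : measurable_fun setT f.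
  by apply: measurable_funM => //; exact: measurable_funD.
have mk : measurable_fun setT
    (shifted_kernel : measurableTypeR R * measurableTypeR R -> R).
  exact: measurable_shifted_kernel.
have f0 q : 0 <= f q by rewrite mulr_ge0 ?(ltW alpha0).
have fM p : (\int[P]_w (expR (a * f (w, p)))%:E <= (C * M)%:E)%E.
  have cT := clamp_itv p.2 T0.
  apply: (@le_trans _ _ (\int[P]_w
    (C%:E * (expR (a * alpha * V (clamp T p.2) w))%:E))%E).
    apply: le_integral_nomeas => w _; first by rewrite lee_fin expR_ge0.
    rewrite -EFinM lee_fin -expRD ler_expR /f/= le_eqVlt; apply/orP; left.
    by apply/eqP; ring.
  have mE : measurable_fun setT (fun w => (expR (a * alpha * V (clamp T p.2) w))%:E).
    apply/measurable_EFinP; apply: measurableT_comp => //.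
    by apply: measurable_funM => //; exact: mV.
  rewrite ge0_integralZl_EFin ?expR_ge0// EFinM.
  by apply: lee_wpmul2l; [rewrite lee_fin expR_ge0|exact: VM].
apply: le_trans (@ge0_expeR_integral_le _ _ _ _ _ P (lebesgue_measure2 R)
  shifted_kernel f a (C * M) a0 mk shifted_kernel_ge0 aE mf f0 fM).
apply: le_integral_nomeas => w _; first exact: expeR_ge0.
rewrite lee_expeR.
pose F (p : measurableTypeR R * measurableTypeR R) :=
  (shifted_kernel p * (V (clamp T p.2) w + x / T))%:E.
have F0 p : (0 <= F p)%E by rewrite lee_fin mulr_ge0 ?shifted_kernel_ge0.
have mF : measurable_fun setT F.
  apply/measurable_EFinP; apply: measurable_funM => //; apply: measurable_funD => //.
  exact: (@measurableT_comp _ _ _ _ _ _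
    (fun q : Omega * (measurableTypeR R * measurableTypeR R) =>
       V (clamp T q.2.2) q.1)
    _ (pair w)).
have -> : (\int[(mu \x mu)%E]_p (shifted_kernel p * f (w, p))%:E =
    alpha%:E * \int[(mu \x mu)%E]_p F p)%E.
  rewrite -ge0_integralZl_EFin ?(ltW alpha0)//.
  by apply: eq_integral => p _; rewrite /F -EFinM; congr EFin; rewrite /f/=; ring.
apply: lee_wpmul2l; first by rewrite lee_fin ltW.
(* Written as an iterated integral, the right side is compared with the left for each outer time: by
   [le_shifted_kernel] on [[0, T]], and by nonnegativity elsewhere. *)
rewrite fubini_tonelli1// integral_mkcond; apply: le_integral_nomeas => t _.
  apply: erestrict_ge0 => s sT; rewrite lee_fin addr_ge0//.
  apply: Rintegral_ge0 => u /= us; have uT : u \in `[0, T].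
    move: us sT; rewrite /= !in_itv/= => /andP[-> us] /andP[_]; exact: le_trans.
  by rewrite mulr_ge0 ?K_ge0 ?V0.
rewrite patchE; case: ifPn => [/set_mem/= tT|_]; last exact: integral_ge0.
exact: le_shifted_kernel (cV w) (fun s => V0 s w) tT.
Qed.

End volterra_bound.

(** * The square-root volatility and the bound uniform in small [eps] *)

Lemma exponential_moment_sqrtr (R : realType) d (Omega : measurableType d)
    (P : probability Omega R) (T alpha : R) (Y : R -> Omega -> R) :
  (forall t w, t \in `[0, T] -> 0 <= Y t w) ->
  exponential_moment P T alpha (fun u => (Num.sqrt u ^+ 2)%R) Y =
  exponential_moment P T alpha id Y.
Proof.
move=> Y0; apply: eq_integral => w _; congr (expeR (_ * _)%E).
(* [Num.sqrt] is 0 on negative numbers, so the sign of [Y] matters here. *)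
by apply: eq_integral => t; rewrite inE/= => tT; rewrite sqr_sqrtr ?Y0.
Qed.

Theorem lemma8p33 (R : realType) (d : measure_display) (Omega : measurableType d)
  (P : probability Omega R)
  (T : R) (K : R -> R -> R) (kappa theta eta v0 x r rho s0 : R)
  (W B : R -> Omega -> R) (V S : R -> R -> Omega -> R)
  (T_gt0 : 0 < T)
  (K_admissible : admissible_volterra_kernel T K)
  (K_ge0 : forall t s : R, t \in `[0, T] -> s \in `[0, T] -> 0 <= K t s)
  (K_assumption_F : assumption_F T K)
  (kappa_gt0 : 0 < kappa) (theta_gt0 : 0 < theta) (eta_gt0 : 0 < eta)
  (v0_gt0 : 0 < v0) (x_ge0 : 0 <= x)
  (r_ge0 : 0 <= r) (rho_bounds : -1 < rho < 1) (s0_gt0 : 0 < s0)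
  (W_brownian : brownian_motion P T W)
  (B_brownian : brownian_motion P T B)
  (WB_independent : independent_processes P T W B)
  (V_solution : forall eps : R, 0 < eps <= 1 ->
     cir_solution P T kappa theta (Num.sqrt eps * eta) v0 B (V eps))
  (S_solution : forall eps : R, 0 < eps <= 1 ->
     asset_price_solution P T r rho eps s0 Num.sqrt W B
       (volterra_process K x (V eps)) (S eps)) :
  forall alpha : R, 0 < alpha ->
  exists eps0 M : R, [/\ 0 < eps0 <= 1, 0 < M &
    forall eps : R, 0 < eps -> eps < eps0 ->
      exponential_moment P T alpha (fun u : R => (Num.sqrt u ^+ 2)%R)
        (volterra_process K x (V eps))
      = exponential_moment P T alpha id (volterra_process K x (V eps)) /\
      (exponential_moment P T alpha (fun u : R => (Num.sqrt u ^+ 2)%R)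
        (volterra_process K x (V eps)) <= M%:E)%E].
Proof.
move=> alpha alpha0.
have T0 : 0 <= T by exact: ltW.
have [a a0 aE] := integral_shifted_kernel T_gt0 K_admissible K_ge0.
pose c := a * alpha.
have c0 : 0 < c by rewrite mulr_gt0.
(* The CIR bound with [Num.sqrt eps] replaced by its upper bound 1, hence free of [eps]. *)
pose M := expR (c * v0 + c * kappa * theta * T + c * eta + (c * eta) ^+ 2).
(* Below the second term of the minimum, [eps * (c * eta ^+ 2) <= kappa], which is the condition of
   [cir_exponential_moment] for [vol = Num.sqrt eps * eta]. *)
exists (Num.min 1 (kappa / (c * eta ^+ 2))), (expR (c * (x / T)) * M); split.
- rewrite lt_min ltr01 ge_min lexx divr_gt0//.
  by rewrite mulr_gt0// exprn_gt0.
- by rewrite mulr_gt0 ?expR_gt0.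
move=> eps eps0; rewrite lt_min => /andP[eps1 eps_small].
have eps01 : 0 < eps <= 1 by rewrite eps0 ltW.
have CIR := V_solution _ eps01.
have [aV cV V0 _] := CIR.
have V0' s w : s \in `[0, T] -> 0 <= V eps s w by move=> sT; exact: V0.
have sqrt1 : Num.sqrt eps <= 1 by rewrite -sqrtr1 ler_wsqrtr// ltW.
have vol0 : 0 <= Num.sqrt eps * eta by rewrite mulr_ge0 ?sqrtr_ge0// ltW.
have volE : (c * (Num.sqrt eps * eta)) ^+ 2 = c * (eps * (c * eta ^+ 2)).
  by rewrite -{2}(sqr_sqrtr (ltW eps0)); ring.
have cvk : (c * (Num.sqrt eps * eta)) ^+ 2 <= c * kappa.
  rewrite volE; apply: ler_wpM2l; first exact: ltW.
  by rewrite -ler_pdivlMr ?mulr_gt0 ?exprn_gt0// ltW.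
have vol_le : c * (Num.sqrt eps * eta) <= c * eta.
  by apply: ler_wpM2l; [exact: ltW|rewrite ler_piMl// ltW].
have VM s : s \in `[0, T] -> (\int[P]_w (expR (c * V eps s w))%:E <= M%:E)%E.
  move=> sT; apply: le_trans
    (cir_exponential_moment B_brownian CIR (ltW kappa_gt0) (ltW theta_gt0) vol0
       (ltW c0) cvk sT) _.
  rewrite lee_fin ler_expR; apply: lerD; first by rewrite lerD2l.
  by rewrite ler_sqr ?nnegrE// mulr_ge0// ltW.
have mV s : s \in `[0, T] -> measurable_fun setT (V eps s).
  by move=> sT; exact: adapted_measurable B_brownian aV sT.
have Y0 t w : t \in `[0, T] -> 0 <= volterra_process K x (V eps) t w.
  move=> tT; rewrite addr_ge0//; apply: Rintegral_ge0 => s /= st.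
  have sT : s \in `[0, T].
    by move: st tT; rewrite !in_itv/= => /andP[-> st] /andP[_]; exact: le_trans.
  by rewrite mulr_ge0 ?K_ge0 ?V0.
rewrite exponential_moment_sqrtr//; split=> //.
have := volterra_exponential_moment T_gt0 K_admissible K_ge0 x_ge0 alpha0 a0 aE
  mV cV V0' VM.
exact.
Qed.
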